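(* Let $N\ge 1$, let $A_N=(a_{ij})_{1\le i,j\le N}$ be a symmetric matrix whose entries are real random variables, and let $D_N=\mathrm{diag}\{d_i\}_{1\le i\le N}$ be a diagonal matrix whose diagonal entries $d_1,\dots,d_N$ are i.i.d. with the Cauchy distribution of density $g(x)=\frac1\pi\frac{\lambda}{x^2+\lambda^2}$, $\lambda>0$. Assume $A_N$ and $D_N$ are independent. Let $F_N$ and $\tilde F_N$ be the empirical spectral distributions of $A_N$ and $A_N+D_N$, respectively, and let $L_N$ be the probability measure on $\mathbb{R}$ with $L_N(-\infty,x]=\mathbb{E}(F_N(x))$. Then the expected empirical spectral distribution $x\mapsto\mathbb{E}(\tilde F_N(x))$ is infinitely differentiable and, with $\tilde\rho_N(x)=\frac{d}{dx}\mathbb{E}(\tilde F_N(x))$, $$\frac{d^k\tilde\rho_N}{dx^k}(x)=\Big(\frac{d^kg}{dx^k}*L_N\Big)(x)=\int_{\mathbb{R}}\frac{d^kg}{dx^k}(x-y)\,dL_N(y)\qquad\text{for all }k\in\mathbb{N}\cup\{0\},\ x\in\mathbb{R}.$$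
   Context: For a real symmetric matrix $M$ of order $N$, its empirical spectral distribution is the function $x\mapsto \frac1N\#\{j:E_j\le x,\ E_j\in\sigma(M)\}$, eigenvalues being counted with multiplicity. $F_N$ and $\tilde F_N$ denote this (random) function for $M=A_N$ and $M=A_N+D_N$, respectively. No assumption is made on the joint distribution of the entries of $A_N$ (apart from symmetry). *)

(* Defs.v *)
From HB Require Import structures.
From mathcomp Require Import all_boot all_order all_algebra.
From mathcomp Require Import all_classical all_reals all_analysis.

Set Implicit Arguments.
Unset Strict Implicit.
Unset Printing Implicit Defensive.

Import Order.TTheory GRing.Theory Num.Theory.
Import numFieldNormedType.Exports.

Local Open Scope classical_set_scope.
Local Open Scope ring_scope.

(* [mup E (char_poly M)] is the algebraic multiplicity of the eigenvalue E.
   The sum has finite support, as M has finitely many eigenvalues. *)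
Definition esd (R : realType) (N : nat) (M : 'M[R]_N) (x : R) : R :=
  N%:R^-1 *
  \sum_(E \in [set E : R | eigenvalue M E /\ E <= x]) ((mup E (char_poly M))%:R : R).

(* Real-valued: [esd] takes its values in [0, 1], so [fine] loses nothing. *)
Definition expected_esd (dT : measure_display) (T : measurableType dT)
    (R : realType) (P : probability T R) (N : nat) (M : T -> 'M[R]_N)
    (x : R) : R :=
  fine ('E_P[fun w => esd (M w) x])%E.

Definition cauchy_density (R : realType) (lambda x : R) : R :=
  pi^-1 * (lambda / (x ^+ 2 + lambda ^+ 2)).

Definition has_density (dT : measure_display) (T : measurableType dT)
    (R : realType) (P : probability T R) (X : {RV P >-> R}) (f : R -> R) : Prop :=
  forall B : set R, measurable B ->
    distribution P X B = (\int[lebesgue_measure]_(x in B) (f x)%:E)%E.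

Definition mutually_independent (dT : measure_display) (T : measurableType dT)
    (R : realType) (P : probability T R) (I : finType)
    (X : I -> {RV P >-> R}) : Prop :=
  forall (J : {set I}) (B : I -> set R),
    (forall i, i \in J -> measurable (B i)) ->
    P (\bigcap_(i in [set` J]) (X i @^-1` B i)) =
    (\prod_(i in J) P (X i @^-1` B i))%E.

Definition sigma_rv (dT : measure_display) (T : measurableType dT)
    (R : realType) (P : probability T R) (I : Type)
    (X : I -> {RV P >-> R}) : set (set T) :=
  <<s [set C | exists i (B : set R), measurable B /\ C = X i @^-1` B] >>.

Definition independent_families (dT : measure_display) (T : measurableType dT)
    (R : realType) (P : probability T R) (I J : Type)
    (X : I -> {RV P >-> R}) (Y : J -> {RV P >-> R}) : Prop :=
  forall U V : set T, sigma_rv X U -> sigma_rv Y V ->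
    P (U `&` V) = (P U * P V)%E.

(* Main.v *)
(** For a matrix [A + diag d] the trace of the resolvent at [z], [Im z > 0], is a
    Moebius function of each [d_j] separately, analytic in the lower half plane,
    because [A] being real symmetric the matrix [diag w - A] is invertible as soon
    as all [Im w_j > 0].  Averaging such a function against the Cauchy density of
    parameter [l] amounts to evaluating it at [-i l], so replacing the [d_j] one at
    a time turns [E tr (z - A - D)^-1] into [E tr (z + i l - A)^-1].  Only the
    (signed, hence Tonelli-friendly) imaginary part is needed: integrated in
    [Re z] and with [Im z -> 0] it gives the expected spectral distribution of
    [A + D] as the convolution of that of [A] with the Cauchy density. *)
Require Import Defs.
From HB Require Import structures.
From mathcomp Require Import all_boot all_order all_algebra.
From mathcomp Require Import spectral complex.
From mathcomp Require Import ring lra.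
From mathcomp Require Import all_classical all_reals all_analysis.
From mathcomp Require Import measurable_realfun.
Import Order.TTheory GRing.Theory Num.Theory.
Import numFieldNormedType.Exports.
Set Implicit Arguments.
Unset Strict Implicit.
Unset Printing Implicit Defensive.

Local Open Scope classical_set_scope.
Local Open Scope ring_scope.

(** As a function of the amount [t] subtracted from the [j]-th diagonal entry, the trace has the
    shape [c0 + c1 / (W - t)] with [Im W > 0], by the rank-one update of an inverse, and its
    imaginary part times the density has an elementary antiderivative. The replacement takes place
    at a fixed height [y = Im z > 0], where the matrix with the Cauchy diagonal is smoothed at width
    [y] and the one without it at width [y + l]. As [y] tends to 0 the first side becomes an
    eigenvalue count and the second stays smooth. The same limit yields the measurability of the
    empirical spectral distribution, whose definition by roots and multiplicities gives no direct
    access to it. What results is the convolution of the density with the expected distribution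
    function of [A]; Tonelli turns it into the convolution of the Cauchy distribution function with
    [L], which can be differentiated under the integral sign any number of times because all
    derivatives of the density are bounded. *)

(** * Resolvents with diagonal in the upper half plane *)

Definition pencil (R : rcfType) (N : nat) (S : 'M[R]_N) (w : 'I_N -> R[i]) :
    'M[R[i]]_N :=
  diag_mx (\row_j w j) - map_mx (real_complex R) S.

Definition resolvent (R : rcfType) (N : nat) (S : 'M[R]_N) (w : 'I_N -> R[i]) :=
  invmx (pencil S w).

Lemma Im_sum (R : rcfType) (I : Type) (r : seq I) (F : I -> R[i]) :
  complex.Im (\sum_(i <- r) F i) = \sum_(i <- r) complex.Im (F i).
Proof.
elim: r => [|a r IH]; first by rewrite !big_nil.
by rewrite !big_cons -IH; case: (F a) => ? ?; case: (\sum_(i <- r) F i).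
Qed.

(** The form of a real symmetric matrix is real even on complex vectors: conjugation only exchanges
    its two summation indices. So the diagonal alone contributes to the imaginary part.
    Invertibility of the pencil and the sign of the resolvent both come from this identity. *)
Lemma Im_pencil_form (R : rcfType) (N : nat) (S : 'M[R]_N) (w : 'I_N -> R[i])
    (x : 'cV[R[i]]_N) : S^T = S ->
  complex.Im (\sum_i conjc (x i 0) * (pencil S w *m x) i 0) =
  \sum_i complex.Im (w i) * (complex.Re (x i 0) ^+ 2 + complex.Im (x i 0) ^+ 2).
Proof.
move=> Ssym.
have -> : \sum_i conjc (x i 0) * (pencil S w *m x) i 0 =
    \sum_i conjc (x i 0) * (w i * x i 0) -
    \sum_i \sum_j conjc (x i 0) * ((S i j)%:C%C * x j 0).
  rewrite -sumrB; apply: eq_bigr => i _.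
  rewrite mulmxBl mul_diag_mx !mxE mulrBr mulr_sumr.
  by congr (_ - _); apply: eq_bigr => j _; rewrite !mxE.
set Q := (X in _ - X).
have Q0 : complex.Im Q = 0.
  have QJ : conjc Q = Q.
    rewrite rmorph_sum/=.
    under eq_bigr do rewrite rmorph_sum/=.
    rewrite exchange_big; apply: eq_bigr => i _; apply: eq_bigr => j _ /=.
    rewrite !rmorphM /= conjcK oppr0 -{1}Ssym mxE.
    by rewrite mulrC -mulrA mulrCA.
  have : complex.Im (conjc Q) = complex.Im Q by rewrite QJ.
  by case: (Q) => a b /= /eqP; rewrite eqNr => /eqP.
have -> : complex.Im (\sum_i conjc (x i 0) * (w i * x i 0) - Q) =
    complex.Im (\sum_i conjc (x i 0) * (w i * x i 0)) - complex.Im Q.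
  by case: (\sum_i _) => ? ?; case: Q {Q0}.
rewrite Q0 subr0 Im_sum; apply: eq_bigr => i _.
by case: (x i 0) => a b; case: (w i) => c d /=; ring.
Qed.

Lemma pencil_unit (R : rcfType) (N : nat) (S : 'M[R]_N) (w : 'I_N -> R[i]) :
  S^T = S -> (forall i, 0 < complex.Im (w i)) -> pencil S w \in unitmx.
Proof.
move=> Ssym w0; rewrite -unitmx_tr -row_free_unit; apply: inj_row_free => v v0.
have := Im_pencil_form w v^T Ssym.
have -> : pencil S w *m v^T = 0 by apply: trmx_inj; rewrite trmx_mul trmxK v0 trmx0.
rewrite big1 => [/esym/eqP|i _]; last by rewrite [X in _ * X]mxE mulr0.
rewrite psumr_eq0 => [/allP v2|i _]; last first.
  by rewrite mulr_ge0 ?addr_ge0 ?sqr_ge0// ltW.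
apply/rowP => i; have := v2 i (mem_index_enum _).
rewrite /= mulf_eq0 gt_eqF//= paddr_eq0 ?sqr_ge0// !sqrf_eq0 !mxE => /andP[].
by case: (v 0 i) => a b /= /eqP -> /eqP ->.
Qed.

Lemma mul_pencil_resolvent (R : rcfType) (N : nat) (S : 'M[R]_N)
    (w : 'I_N -> R[i]) (S_sym : S^T = S) (w_gt0 : forall i, 0 < complex.Im (w i)) :
  pencil S w *m resolvent S w = 1%:M.
Proof. by rewrite mulmxV// pencil_unit. Qed.

(** Evaluate the form of the pencil at [x], the [k]-th column of the resolvent: since the pencil
    sends [x] to the [k]-th basis vector, the form equals the conjugate of the diagonal entry. Its
    imaginary part is a sum of squares with positive weights, and it is not zero because [x] is
    not. *)
Lemma Im_resolvent_lt0 (R : rcfType) (N : nat) (S : 'M[R]_N) (w : 'I_N -> R[i]) k :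
  S^T = S -> (forall i, 0 < complex.Im (w i)) ->
  complex.Im (resolvent S w k k) < 0.
Proof.
move=> Ssym w0; have Gw := mul_pencil_resolvent Ssym w0.
set x := col k (resolvent S w).
have ex : pencil S w *m x = col k 1%:M by rewrite /x !colE mulmxA Gw.
have := Im_pencil_form w x Ssym; rewrite ex (bigD1 k)//= big1 => [|i ik]; last first.
  by rewrite !mxE (negbTE ik) mulr0.
rewrite !mxE eqxx addr0 mulr1 => e.
have : 0 < complex.Im (conjc (resolvent S w k k)).
  rewrite e lt_neqAle; apply/andP; split; last first.
    by apply: sumr_ge0 => i _; rewrite mulr_ge0 ?addr_ge0 ?sqr_ge0// ltW.
  apply/eqP => /esym/eqP; rewrite psumr_eq0 => [/allP v2|i _]; last first.
    by rewrite mulr_ge0 ?addr_ge0 ?sqr_ge0// ltW.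
  suff x0 : x = 0.
    by have /matrixP/(_ k 0)/eqP := ex; rewrite x0 mulmx0 !mxE eqxx eq_sym oner_eq0.
  apply/colP => i; have := v2 i (mem_index_enum _).
  rewrite /= mulf_eq0 gt_eqF//= paddr_eq0 ?sqr_ge0// !sqrf_eq0 => /andP[].
  by rewrite [RHS]mxE; case: (x i 0) => a b /= /eqP -> /eqP ->.
by case: (resolvent S w k k) => a b /=; rewrite oppr_gt0.
Qed.

(** The Sherman-Morrison formula for a rank-one change on the diagonal, restricted to diagonal
    entries, which are all that a trace sees. *)
Lemma invmx_sub_delta (F : fieldType) (N : nat) (A : 'M[F]_N) (j : 'I_N) (t : F) :
  A \in unitmx -> A - t *: delta_mx j j \in unitmx ->
  1 - t * invmx A j j != 0 /\
  forall k, invmx (A - t *: delta_mx j j) k k =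
    invmx A k k + t * (invmx A k j * invmx A j k) / (1 - t * invmx A j j).
Proof.
move=> uA uA'; set G := invmx A; set A' := A - _.
have EG : delta_mx j j *m G = delta_mx j 0 *m row j G.
  by rewrite rowE mulmxA mul_delta_mx.
have colG : A' *m col j G = (1 - t * G j j) *: delta_mx j (0 : 'I_1).
  rewrite colE mulmxA mulmxBl mulmxV// -scalemxAl EG mulmxBl mul1mx.
  rewrite -scalemxAl -mulmxA -colE scalerBl scale1r; congr (_ - _).
  have -> : col j (row j G) = (G j j)%:M by apply/matrixP => a b; rewrite !mxE !ord1.
  by rewrite mul_mx_scalar scalerA.
(* Were the scalar zero, [A'] would kill the [j]-th column of [G]; but [A] sends that column to a
   basis vector, so it is not zero. *)
have nz : 1 - t * G j j != 0.
  apply/eqP => z; move: colG; rewrite z scale0r => /(congr1 (mulmx (invmx A'))).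
  rewrite mulKmx// mulmx0 colE => /(congr1 (mulmx A)); rewrite mulKVmx// mulmx0.
  by move=> /matrixP/(_ j 0)/eqP; rewrite !mxE !eqxx oner_eq0.
split=> // k.
have A'V : A' *m (G + (t / (1 - t * G j j)) *: (col j G *m row j G)) = 1%:M.
  rewrite mulmxDr -scalemxAr mulmxA colG -scalemxAl scalerA divfK//.
  by rewrite mulmxBl mulmxV// -scalemxAl EG subrK.
have -> : invmx A' = G + (t / (1 - t * G j j)) *: (col j G *m row j G).
  by rewrite -[LHS]mulmx1 -A'V mulKmx.
by rewrite !mxE big_ord1 !mxE; congr (_ + _); rewrite mulrAC.
Qed.

(** * Spectrum, Poisson trace and empirical spectral distribution *)

Lemma char_poly_conj (F : fieldType) (N : nat) (P A : 'M[F]_N) :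
  P \in unitmx -> char_poly (invmx P *m A *m P) = char_poly A.
Proof.
move=> uP; rewrite /char_poly /char_poly_mx.
have PP : map_mx (@polyC F) (invmx P) *m map_mx (@polyC F) P = 1%:M.
  by rewrite -map_mxM/= mulVmx// map_mx1.
have -> : 'X%:M - map_mx (@polyC F) (invmx P *m A *m P) =
    map_mx (@polyC F) (invmx P) *m ('X%:M - map_mx (@polyC F) A) *m map_mx (@polyC F) P.
  rewrite !map_mxM mulmxBr mulmxBl scalar_mxC -[X in _ = X - _]mulmxA PP.
  by rewrite mulmx1.
by rewrite !det_mulmx mulrAC -det_mulmx PP det1 mul1r.
Qed.

Lemma char_poly_diag (F : fieldType) (N : nat) (v : 'rV[F]_N) :
  char_poly (diag_mx v) = \prod_j ('X - (v 0 j)%:P).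
Proof.
rewrite char_poly_trig ?diag_mx_is_trig//.
by apply: eq_bigr => i _; rewrite mxE eqxx mulr1n.
Qed.

(** Diagonalise over [R[i]], where a real symmetric matrix is hermitian and has real eigenvalues.
    One family [e] serves both the characteristic polynomial over [R], from which multiplicities are
    counted, and the complex resolvent. *)
Lemma sym_spectrum (R : rcfType) (N : nat) (S : 'M[R]_N) : S^T = S ->
  exists e : 'I_N -> R, char_poly S = \prod_j ('X - (e j)%:P) /\
  forall z : R[i], (forall j, z != (e j)%:C%C) ->
    \tr (resolvent S (fun=> z)) = \sum_j (z - (e j)%:C%C)^-1.
Proof.
move=> Ssym; pose SC := map_mx (real_complex R) S.
have herm : SC \is hermsymmx.
  apply: realsym_hermsym.
    by apply/is_hermitianmxP; rewrite expr0 scale1r map_mx_id// /SC map_trmx Ssym.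
  by apply/mxOverP => i j; rewrite mxE; apply/complex_realP; exists (S i j).
have /orthomx_spectralP := hermitian_normalmx herm.
have := hermitian_spectral_diag_real herm.
have := spectral_unit SC.
set P := spectralmx _; set v := spectral_diag _ => uP /mxOverP vr SE.
pose e j := complex.Re (v 0 j).
have vE j : v 0 j = (e j)%:C%C by rewrite /e RRe_real.
exists e; split.
  apply: (@map_poly_inj _ _ (real_complex R)).
  rewrite map_char_poly -/SC SE char_poly_conj// char_poly_diag rmorph_prod.
  by apply: eq_bigr => j _; rewrite rmorphB/= map_polyX map_polyC/= vE.
move=> z zne.
pose d := \row_j (z - v 0 j).
pose d' := \row_j (z - v 0 j)^-1.
have pE : pencil S (fun=> z) = invmx P *m diag_mx d *m P.
  have -> : diag_mx d = z%:M - diag_mx v.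
    by apply/matrixP => i j; rewrite !mxE mulrnBl.
  rewrite mulmxBr mulmxBl -SE scalar_mxC -[X in _ = X - _]mulmxA mulVmx// mulmx1.
  by congr (_ - _); apply/matrixP => i j; rewrite !mxE.
have dd' : diag_mx d *m diag_mx d' = 1%:M.
  rewrite mulmx_diag -diag_const_mx; congr diag_mx; apply/rowP => j.
  by rewrite !mxE mulfV// subr_eq0 vE.
have pV : pencil S (fun=> z) *m (invmx P *m diag_mx d' *m P) = 1%:M.
  rewrite pE !mulmxA mulmxK// -[X in X *m P]mulmxA dd' mulmx1.
  by rewrite mulVmx.
have -> : resolvent S (fun=> z) = invmx P *m diag_mx d' *m P.
  have [u _] := mulmx1_unit pV.
  by rewrite -[LHS]mulmx1 -pV; exact: (mulKmx u).
rewrite mxtrace_mulC mulKVmx// mxtrace_diag.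
by apply: eq_bigr => j _; rewrite mxE vE.
Qed.


(** Up to the factor [pi], the Poisson integral at height [y] of the eigenvalue counting measure;
    the minus sign makes it nonnegative. *)
Definition poisson_trace (R : rcfType) (N : nat) (S : 'M[R]_N) (x y : R) : R :=
  - complex.Im (\tr (resolvent S (fun=> (x +i* y)%C))).

Lemma poisson_trace_spectrum (R : rcfType) (N : nat) (S : 'M[R]_N) : S^T = S ->
  exists e : 'I_N -> R, char_poly S = \prod_j ('X - (e j)%:P) /\
  forall x y : R, 0 < y ->
    poisson_trace S x y = \sum_j y / ((x - e j) ^+ 2 + y ^+ 2).
Proof.
move=> /sym_spectrum[e [cE tE]]; exists e; split=> // x y y0.
rewrite /poisson_trace tE => [|j]; last first.
  by rewrite eq_complex/= negb_and orbC gt_eqF.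
rewrite Im_sum -sumrN; apply: eq_bigr => j _ /=.
by rewrite subr0 opprK.
Qed.

Lemma esd_spectrum (R : realType) (N : nat) (S : 'M[R]_N) (e : 'I_N -> R) (x : R) :
  char_poly S = \prod_j ('X - (e j)%:P) ->
  esd S x = N%:R^-1 * \sum_j ((e j <= x)%R)%:R.
Proof.
pose s := [seq e j | j <- index_enum 'I_N].
have -> : \prod_j ('X - (e j)%:P) = \prod_(y <- s) ('X - y%:P) by rewrite big_map.
move=> cE; rewrite /esd; congr (_ * _).
pose r := [seq y <- undup s | y <= x].
have -> : [set E | eigenvalue S E /\ E <= x] = [set` r].
  apply/seteqP; split=> E /=; rewrite eigenvalue_root_char cE root_prod_XsubC.
    by move=> [Es Ex]; rewrite mem_filter Ex mem_undup.
  by rewrite mem_filter mem_undup => /andP[].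
rewrite -fsbig_seq ?filter_uniq ?undup_uniq//=.
(* A multiplicity is a number of occurrences in [s]. After the exchange of sums each [e j] meets the
   duplicate-free list [r] once if [e j <= x], and never otherwise. *)
transitivity (\sum_(E <- r) \sum_(y <- s) ((y == E)%:R : R)).
  apply: eq_bigr => E _; rewrite cE mu_prod_XsubC -sum1_count natr_sum big_mkcond.
  by apply: eq_bigr => y _ /=; case: (y == E).
rewrite exchange_big/= big_map; apply: eq_bigr => j _.
have [ejx|ejx] := boolP (e j <= x).
  rewrite (bigD1_seq (e j)) ?filter_uniq ?undup_uniq//=; last first.
    by rewrite mem_filter ejx mem_undup map_f// mem_index_enum.
  by rewrite eqxx big1 ?addr0// => E /negbTE; rewrite eq_sym => ->.
rewrite big1_seq// => E /andP[_]; rewrite mem_filter => /andP[Ex _].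
by case: eqP => // eE; rewrite eE Ex in ejx.
Qed.

(** * Improper integrals and the Cauchy average of a simple pole *)

Lemma ge0_FTCy (R : realType) (f F : R -> R) (a l : R) :
  (forall x, 0 <= f x) -> continuous f -> (forall x : R, is_derive x 1 F (f x)) ->
  F x @[x --> +oo] --> l ->
  (\int[lebesgue_measure]_(x in `[a, +oo[) (f x)%:E = (l - F a)%:E)%E.
Proof.
move=> f0 cf dF Fl.
rewrite (@ge0_continuous_FTC2y _ f F a l)//.
- exact: continuous_subspaceT.
- apply: cvg_at_right_filter; apply: differentiable_continuous.
  by apply/derivable1_diffP; exact: ex_derive.
- by move=> x _; rewrite derive1E derive_val.
Qed.

Lemma ge0_FTCNy (R : realType) (f F : R -> R) (a m : R) :
  (forall x, 0 <= f x) -> continuous f -> (forall x : R, is_derive x 1 F (f x)) ->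
  F x @[x --> -oo] --> m ->
  (\int[lebesgue_measure]_(x in `]-oo, a]) (f x)%:E = (F a - m)%:E)%E.
Proof.
move=> f0 cf dF Fl.
rewrite -[a]opprK ge0_integration_by_substitutionNy//; last exact: continuous_subspaceT.
have dG (x : R) : is_derive x 1 (fun x => - F (- x)) (f (- x)).
  have dN : is_derive x 1 (-%R : R -> R) (-1) by exact: is_deriveNid.
  have /= := @is_derive1_comp _ F -%R x (f (- x)) (-1) (dF (- x)) dN.
  by move=> /is_deriveN H; apply: (is_derive_eq H); rewrite mulrN1 opprK.
have cG : continuous (f \o -%R).
  by move=> x; apply: continuous_comp; [exact: opp_continuous|exact: cf].
have lG : - F (- x) @[x --> +oo] --> - m by apply: cvgN; apply/cvgNy_compNP.
by rewrite (ge0_FTCy (- a) (fun x => f0 (- x)) cG dG lG) !opprK addrC.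
Qed.

Lemma ge0_FTCT (R : realType) (f F : R -> R) (l m : R) :
  (forall x, 0 <= f x) -> continuous f -> (forall x : R, is_derive x 1 F (f x)) ->
  F x @[x --> +oo] --> l -> F x @[x --> -oo] --> m ->
  (\int[lebesgue_measure]_x (f x)%:E = (l - m)%:E)%E.
Proof.
move=> f0 cf dF Fl Fm.
rewrite -(setUv `]-oo, 0]) ge0_integral_setU//=; last 4 first.
- exact: measurableC.
- by apply/measurable_EFinP; rewrite setUv; exact: continuous_measurable_fun.
- by move=> x _; rewrite lee_fin.
- exact/disj_setPCl.
rewrite (ge0_FTCNy 0 f0 cf dF Fm) setCitvl integral_itv_obnd_cbnd; last first.
  by apply/measurable_EFinP/measurable_funTS; exact: continuous_measurable_fun.
by rewrite (ge0_FTCy 0 f0 cf dF Fl) -EFinD addrC addrA subrK.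
Qed.

Lemma sqr_add_sqr_gt0 (R : realDomainType) (u v : R) :
  0 < v -> 0 < u ^+ 2 + v ^+ 2.
Proof. by move=> v0; rewrite ltr_wpDl ?sqr_ge0 ?exprn_gt0. Qed.

Lemma is_derive_atan_affine (R : realType) (u v t : R) : 0 < v ->
  is_derive t 1 (fun t => atan ((t - u) / v)) (v / ((t - u) ^+ 2 + v ^+ 2)).
Proof.
move=> v0.
have d1 : is_derive t 1 (fun t => (t - u) / v) v^-1.
  have -> : (fun t => (t - u) / v) = (v^-1 \*: (id - cst u)) :> (R -> R).
    by apply/funext => s /=; rewrite mulrC.
  by apply: is_derive_eq; rewrite /GRing.scale/= subr0 mulr1.
have /= := @is_derive1_comp _ atan _ t _ _ (is_derive1_atan _) d1.
move=> H; apply: (is_derive_eq H); field.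
by rewrite !gt_eqF// sqr_add_sqr_gt0.
Qed.

Lemma is_derive_ln_sqr (R : realType) (u v t : R) : 0 < v ->
  is_derive t 1 (fun t => ln ((t - u) ^+ 2 + v ^+ 2))
    (2 * (t - u) / ((t - u) ^+ 2 + v ^+ 2)).
Proof.
move=> v0.
have d1 : is_derive t 1 (fun t => (t - u) ^+ 2 + v ^+ 2) (2 * (t - u)).
  have -> : (fun t => (t - u) ^+ 2 + v ^+ 2) = ((id - cst u) ^+ 2 + cst (v ^+ 2)) :> (R -> R).
    by [].
  by apply: is_derive_eq; rewrite /GRing.scale/= !fctE/=; ring.
have p : 0 < (t - u) ^+ 2 + v ^+ 2 by exact: sqr_add_sqr_gt0.
have /= := @is_derive1_comp _ (@ln R) _ t _ _ (is_derive1_ln p) d1.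
by move=> H; apply: (is_derive_eq H); rewrite mulrC.
Qed.

Lemma cvgy_atan_affine (R : realType) (u v : R) : 0 < v ->
  atan ((t - u) / v) @[t --> +oo] --> pi / 2.
Proof.
move=> v0; apply: (cvg_comp _ _ _ (@cvgy_atan R)).
apply/cvgryPge => M; near=> t.
rewrite ler_pdivlMr// lerBrDr; near: t; apply: nbhs_pinfty_ge; exact: num_real.
Unshelve. all: by end_near. Qed.

Lemma cvgNy_atan_affine (R : realType) (u v : R) : 0 < v ->
  atan ((t - u) / v) @[t --> -oo] --> - (pi / 2).
Proof.
move=> v0; apply/cvgNy_compNP.
have -> : (fun t => atan ((t - u) / v)) \o -%R = (fun t => - atan ((t - - u) / v)).
  by apply/funext => t /=; rewrite -atanN -mulNr; congr (atan (_ / _)); ring.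
by apply: cvgN; exact: cvgy_atan_affine.
Qed.

(** Each logarithm diverges, but in the variable [1 / t] the quotient of their arguments is a
    rational function with value 1 at 0. The abstract filter covers both ends of the line at
    once. *)
Lemma cvg_ln_ratio (R : realType) (F : set_system R) (FF : Filter F) (l u v : R) :
  0 < l -> 0 < v -> x^-1 @[x --> F] --> (0 : R) -> (\forall x \near F, x != 0) ->
  ln ((t - 0) ^+ 2 + l ^+ 2) - ln ((t - u) ^+ 2 + v ^+ 2) @[t --> F] --> (0 : R).
Proof.
move=> l0 v0 F0 Fn.
pose g (s : R) := (1 + (l * s) ^+ 2) / ((1 - u * s) ^+ 2 + (v * s) ^+ 2).
have cg : g x^-1 @[x --> F] --> (1 : R).
  have -> : (1 : R) = (1 + (l * 0) ^+ 2) / ((1 - u * 0) ^+ 2 + (v * 0) ^+ 2).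
    by rewrite !mulr0 subr0 expr1n expr0n/= !addr0 divr1.
  have cM c : c * x^-1 @[x --> F] --> c * 0 by apply: cvgM => //; exact: cvg_cst.
  have c2 (f : R -> R) (a : R) : f x @[x --> F] --> a -> f x ^+ 2 @[x --> F] --> a ^+ 2.
    by move=> fa; rewrite expr2; under eq_fun do rewrite expr2; exact: cvgM.
  apply: cvgM; first by apply: cvgD; [exact: cvg_cst|exact: c2].
  apply: cvgV; first by rewrite !mulr0 subr0 expr1n expr0n addr0 oner_neq0.
  by apply: cvgD; apply: c2 => //; apply: cvgB => //; exact: cvg_cst.
have lng : ln (g x^-1) @[x --> F] --> ln (1 : R).
  by apply: (cvg_comp _ _ cg); exact: continuous_ln.
rewrite ln1 in lng; apply: cvg_trans lng; apply: near_eq_cvg; near=> t.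
have t0 : t != 0 by near: t.
rewrite -ln_div ?posrE ?sqr_add_sqr_gt0//; congr ln; rewrite /g.
field; rewrite t0/= gt_eqF ?sqr_add_sqr_gt0//=.
Unshelve. all: by end_near. Qed.

Lemma cvg_affine_div_sqr (R : realType) (F : set_system R) (FF : Filter F) (l a b : R) :
  0 < l -> x^-1 @[x --> F] --> (0 : R) -> (\forall x \near F, x != 0) ->
  (a * t + b) / (t ^+ 2 + l ^+ 2) @[t --> F] --> (0 : R).
Proof.
move=> l0 F0 Fn.
pose g (s : R) := s * (a + b * s) / (1 + (l * s) ^+ 2).
have cg : g x^-1 @[x --> F] --> (0 : R).
  have -> : (0 : R) = 0 * (a + b * 0) / (1 + (l * 0) ^+ 2) by rewrite !mul0r.
  have cM c : c * x^-1 @[x --> F] --> c * 0 by apply: cvgM => //; exact: cvg_cst.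
  apply: cvgM.
    by apply: cvgM => //; apply: cvgD => //; exact: cvg_cst.
  apply: cvgV; first by rewrite !mulr0 expr0n addr0 oner_neq0.
  apply: cvgD; first exact: cvg_cst.
  by rewrite expr2; under eq_fun do rewrite expr2; exact: cvgM.
apply: cvg_trans cg; apply: near_eq_cvg; near=> t.
have t0 : t != 0 by near: t.
rewrite /g; field; rewrite t0/= gt_eqF ?sqr_add_sqr_gt0//=.
Unshelve. all: by end_near. Qed.

Lemma continuous_sqr_add_sqr (R : realType) (u v : R) :
  continuous (fun t : R => (t - u) ^+ 2 + v ^+ 2).
Proof.
move=> t; apply: cvgD; last exact: cvg_cst.
by rewrite expr2; under eq_fun do rewrite expr2; apply: cvgM;
  apply: cvgB => //; exact: cvg_cst.
Qed.

Lemma continuous_cauchy_density (R : realType) (l : R) : 0 < l ->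
  continuous (cauchy_density l).
Proof.
move=> l0 t; apply: cvgM; first exact: cvg_cst.
apply: cvgM; first exact: cvg_cst.
have cs : continuous (fun t : R => t ^+ 2 + l ^+ 2).
  have -> : (fun t : R => t ^+ 2 + l ^+ 2) = (fun t => (t - 0) ^+ 2 + l ^+ 2).
    by apply/funext => s; rewrite subr0.
  exact: continuous_sqr_add_sqr.
by apply: cvgV; [rewrite gt_eqF ?sqr_add_sqr_gt0|exact: cs].
Qed.

Lemma cauchy_density_ge0 (R : realType) (l t : R) : 0 < l -> 0 <= cauchy_density l t.
Proof.
move=> l0; rewrite mulr_ge0 ?invr_ge0 ?pi_ge0// divr_ge0 ?ltW//.
exact: sqr_add_sqr_gt0.
Qed.

Lemma is_derive1V (R : realType) (f : R -> R) (x df : R) : f x != 0 ->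
  is_derive x 1 f df -> is_derive x 1 (fun y => (f y)^-1) (- (f x) ^- 2 * df).
Proof.
move=> fx0 dfx; apply: DeriveDef; first exact: derivableV.
by rewrite deriveV// derive_val.
Qed.

Lemma is_derive_affine_div_sqr (R : realType) (l a b t : R) : 0 < l ->
  is_derive t 1 (fun t => (a * t + b) / (t ^+ 2 + l ^+ 2))
   ((a * (t ^+ 2 + l ^+ 2) - 2 * t * (a * t + b)) / (t ^+ 2 + l ^+ 2) ^+ 2).
Proof.
move=> l0; have D0 : t ^+ 2 + l ^+ 2 != 0 by rewrite gt_eqF ?sqr_add_sqr_gt0.
have d1 : is_derive t 1 (fun t => t ^+ 2 + l ^+ 2) (2 * t).
  have -> : (fun t => t ^+ 2 + l ^+ 2) = (id ^+ 2 + cst (l ^+ 2)) :> (R -> R) by [].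
  by apply: is_derive_eq; rewrite /GRing.scale/= ?fctE/=; ring.
have d2 : is_derive t 1 (fun t => a * t + b) a.
  have -> : (fun t => a * t + b) = (a \*: id + cst b) :> (R -> R) by [].
  by apply: is_derive_eq; rewrite /GRing.scale/= ?fctE/=; ring.
have dV := @is_derive1V _ (fun t => t ^+ 2 + l ^+ 2) t _ D0 d1.
have H := is_deriveM d2 dV.
by apply: (is_derive_eq H); rewrite /GRing.scale/=; field.
Qed.

(** With [W = u + iv], the fraction is minus the imaginary part of [(p + iq) / (W - t)], and the
    right-hand side is the same expression at [t = -il]. In place of residues there is an explicit
    antiderivative on the real line; nonnegativity lets its limits at both ends give the
    integral. *)
Lemma cauchy_integral_pole (R : realType) (l k p q u v : R) : 0 < l -> 0 < v ->
  (forall t, 0 <= k + (p * v - q * (u - t)) / ((t - u) ^+ 2 + v ^+ 2)) ->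
  (\int[lebesgue_measure]_t (cauchy_density l t *
     (k + (p * v - q * (u - t)) / ((t - u) ^+ 2 + v ^+ 2)))%:E =
   (k + (p * (v + l) - q * u) / (u ^+ 2 + (v + l) ^+ 2))%:E)%E.
Proof.
move=> l0 v0 h0.
have pi0 : (pi : R) != 0 by rewrite gt_eqF ?pi_gt0.
have Dl t : t ^+ 2 + l ^+ 2 != 0 by rewrite gt_eqF ?sqr_add_sqr_gt0.
have Dv t : (t - u) ^+ 2 + v ^+ 2 != 0 by rewrite gt_eqF ?sqr_add_sqr_gt0.
have Dvl : u ^+ 2 + (v + l) ^+ 2 != 0 by rewrite gt_eqF ?sqr_add_sqr_gt0 ?addr_gt0.
have l1 : l != 0 by rewrite gt_eqF.
have v1 : v != 0 by rewrite gt_eqF.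
pose f t := cauchy_density l t *
     (k + (p * v - q * (u - t)) / ((t - u) ^+ 2 + v ^+ 2)).
have f0 t : 0 <= f t.
  by rewrite mulr_ge0// cauchy_density_ge0.
have cf : continuous f.
  move=> t; apply: cvgM; first exact: continuous_cauchy_density.
  apply: cvgD; first exact: cvg_cst.
  apply: cvgM; last by apply: cvgV => //; exact: continuous_sqr_add_sqr.
  apply: cvgB; first exact: cvg_cst.
  apply: cvgM; first exact: cvg_cst.
  by apply: cvgB => //; exact: cvg_cst.
have Vy : x^-1 @[x --> +oo] --> (0 : R).
  apply/(@gtr0_cvgV0 _ _ _ _ id) => //.
  by apply: nbhs_pinfty_gt; exact: num_real.
have Vny : x^-1 @[x --> -oo] --> (0 : R).
  apply/(@ltr0_cvgV0 _ _ _ _ id) => //.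
  by apply: nbhs_ninfty_lt; exact: num_real.
have ny : \forall x \near (+oo : set_system R), x != 0.
  near=> x; rewrite gt_eqF//; near: x; apply: nbhs_pinfty_gt; exact: num_real.
have nny : \forall x \near (-oo : set_system R), x != 0.
  near=> x; rewrite lt_eqF//; near: x; apply: nbhs_ninfty_lt; exact: num_real.
(* Partial fractions; the poles of the two factors collide when [u + iv = il]. *)
have [/andP[/eqP u0 /eqP vl]|nondeg] := boolP ((u == 0) && (v == l)).

  (* Here the denominator is the square of [t ^+ 2 + l ^+ 2], whence an arctangent plus a rational
     term that vanishes at both ends. *)
  pose F t := (k + p / (2 * l)) / pi * atan ((t - 0) / l) +
    (p / (2 * pi) * t + - (q * l / (2 * pi))) / (t ^+ 2 + l ^+ 2).
  have dF (t : R) : is_derive t 1 F (f t).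
    have H := is_deriveD
      (is_deriveZ ((k + p / (2 * l)) / pi) (is_derive_atan_affine 0 t l0))
      (is_derive_affine_div_sqr (p / (2 * pi)) (- (q * l / (2 * pi))) t l0).
    apply: (is_derive_eq H).
    rewrite /GRing.scale/= /f /cauchy_density u0 vl !subr0.
    by move: (pi : R) pi0 => c c0; field; rewrite c0 Dl l1.
  have Fy : F t @[t --> +oo] --> (k + p / (2 * l)) / pi * (pi / 2) + 0.
    apply: cvgD; last exact: cvg_affine_div_sqr.
    by apply: cvgM; [exact: cvg_cst|exact: cvgy_atan_affine].
  have FNy : F t @[t --> -oo] --> (k + p / (2 * l)) / pi * (- (pi / 2)) + 0.
    apply: cvgD; last exact: cvg_affine_div_sqr.
    by apply: cvgM; [exact: cvg_cst|exact: cvgNy_atan_affine].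
  rewrite (ge0_FTCT f0 cf dF Fy FNy) u0 vl; congr EFin.
  move: (pi : R) pi0 => c c0; field.
  by rewrite c0 l1 -mulr2n mulrn_eq0 l1.
have Dd : (u ^+ 2 + v ^+ 2 - l ^+ 2) ^+ 2 + (2 * u * l) ^+ 2 != 0.
  have -> : (u ^+ 2 + v ^+ 2 - l ^+ 2) ^+ 2 + (2 * u * l) ^+ 2 =
     (u ^+ 2 + (v + l) ^+ 2) * (u ^+ 2 + (v - l) ^+ 2) by ring.
  rewrite mulf_neq0// paddr_eq0 ?sqr_ge0// !sqrf_eq0 subr_eq0.
  exact: nondeg.
(* The decomposition is [l (m + q t) / ((t^2 + l^2) ((t - u)^2 + v^2)) = (a t + b) / (t^2 + l^2) +
   (c - a (t - u)) / ((t - u)^2 + v^2)]. Evaluation at the pole [t = il], where the second quadratic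
   equals [s - 2iul], gives [a] and [b]; [t = 0] gives [c]. The opposite coefficients of [t] join
   the two logarithms into a difference that tends to 0. *)
pose m := p * v - q * u; pose s := u ^+ 2 + v ^+ 2 - l ^+ 2.
pose Dt := s ^+ 2 + (2 * u * l) ^+ 2.
pose b := l * (m * s - 2 * u * q * l ^+ 2) / Dt.
pose a := (2 * u * l * m + q * l * s) / Dt.
pose c := (l * m - b * (u ^+ 2 + v ^+ 2)) / l ^+ 2 - a * u.
pose F t := (k + b / l) / pi * atan ((t - 0) / l) + c / (v * pi) * atan ((t - u) / v)
  + a / (2 * pi) * (ln ((t - 0) ^+ 2 + l ^+ 2) - ln ((t - u) ^+ 2 + v ^+ 2)).
have dF (t : R) : is_derive t 1 F (f t).
  have H := is_deriveD (is_deriveD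
      (is_deriveZ ((k + b / l) / pi) (is_derive_atan_affine 0 t l0))
      (is_deriveZ (c / (v * pi)) (is_derive_atan_affine u t v0)))
      (is_deriveZ (a / (2 * pi)) (is_deriveB
        (is_derive_ln_sqr 0 t l0) (is_derive_ln_sqr u t v0))).
  apply: (is_derive_eq H).
  rewrite /GRing.scale/= /f /cauchy_density !subr0 /c /b /a /Dt /m /s.
  move: (pi : R) pi0 => c0 c00; field.
  by rewrite l1 Dl c00 Dv Dd v1.
have Fy : F t @[t --> +oo] -->
    (k + b / l) / pi * (pi / 2) + c / (v * pi) * (pi / 2) + a / (2 * pi) * 0.
  by do 2?[apply: cvgD]; apply: cvgM; first
    [exact: cvg_cst|exact: cvgy_atan_affine|exact: cvg_ln_ratio].
have FNy : F t @[t --> -oo] -->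
    (k + b / l) / pi * (- (pi / 2)) + c / (v * pi) * (- (pi / 2)) + a / (2 * pi) * 0.
  by do 2?[apply: cvgD]; apply: cvgM; first
    [exact: cvg_cst|exact: cvgNy_atan_affine|exact: cvg_ln_ratio].
rewrite (ge0_FTCT f0 cf dF Fy FNy); congr EFin.
rewrite /c /b /a /Dt /m /s.
move: (pi : R) pi0 => c0 c00; field.
by rewrite Dvl c00 l1 v1 Dd.
Unshelve. all: by end_near. Qed.

(** * Averaging the resolvent trace over one diagonal entry *)

(** The rank-one update adds [t * kap / (1 - t * g)] to the trace, where [g] is the [j]-th diagonal
    entry of the resolvent; with [W = g^-1] this is [- kap / g + (kap / g ^+ 2) / (W - t)].
    [Im g < 0] puts [W] in the upper half plane. The constants are the same for all [t] in the
    closed lower half plane, which contains both the real line of integration and the evaluation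
    point [-il]. *)
Lemma resolvent_trace_shift (R : rcfType) (N : nat) (S : 'M[R]_N)
    (w : 'I_N -> R[i]) (j : 'I_N) :
  S^T = S -> (forall i, 0 < complex.Im (w i)) ->
  exists W c0 c1 : R[i], 0 < complex.Im W /\
    forall t, complex.Im t <= 0 ->
      \tr (resolvent S (fun i => if i == j then w i - t else w i)) = c0 + c1 / (W - t).
Proof.
move=> Ssym w0; pose G := resolvent S w; pose g := G j j.
pose kap := \sum_k G k j * G j k.
have g0 : complex.Im g < 0 by exact: Im_resolvent_lt0.
have gn : g != 0 by apply: contraTneq g0 => ->; rewrite ltxx.
exists g^-1, (\tr G - kap / g), (kap / g ^+ 2); split.
  case: (g) g0 gn => a b /= b0 gn.
  rewrite -mulNr divr_gt0 ?oppr_gt0//.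
  by rewrite ltr_wpDl ?sqr_ge0// -sqrrN exprn_gt0 ?oppr_gt0.
move=> t t0; set w' := fun i => _.
have pE : pencil S w' = pencil S w - t *: delta_mx j j.
  apply/matrixP => a b; rewrite !mxE /w'.
  have [<-|ab] := eqVneq a b; last first.
    rewrite /= !mulr0n; case: eqVneq => [aj|]; last by rewrite mulr0 subr0.
    by rewrite /= -aj eq_sym (negbTE ab) mulr0 subr0.
  by rewrite andbb !mulr1n; case: (a == j); rewrite /= ?mulr1 ?mulr0 ?subr0// addrAC.
have w'0 i : 0 < complex.Im (w' i).
  rewrite /w'; case: ifP => // _; have := w0 i.
  by case: (w i) (t) t0 => a b [c d] /= d0 b0; rewrite subr_gt0 (le_lt_trans d0).
have u := pencil_unit Ssym w0; have u' := pencil_unit Ssym w'0.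
rewrite pE in u'; have [nz GE] := invmx_sub_delta u u'.
rewrite -/(resolvent S w) -/G -/g in nz GE.
rewrite /resolvent pE /mxtrace; under eq_bigr do rewrite GE.
rewrite big_split/= -/G -/(mxtrace G) -addrA; congr (_ + _).
under eq_bigr do rewrite mulrAC mulrC.
rewrite -mulr_suml -/kap.
have gt : g^-1 - t != 0.
  apply: contra nz => /eqP/(congr1 (fun z => z * g)); rewrite mul0r mulrBl mulVf//.
  by move=> ->.
by field; rewrite gn mulNr nz.
Qed.

Lemma Im_resolvent_trace_le0 (R : rcfType) (N : nat) (S : 'M[R]_N) (w : 'I_N -> R[i]) :
  S^T = S -> (forall i, 0 < complex.Im (w i)) ->
  complex.Im (\tr (resolvent S w)) <= 0.
Proof.
by move=> Ssym w0; rewrite Im_sum; apply: sumr_le0 => i _; exact/ltW/Im_resolvent_lt0.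
Qed.

Lemma cauchy_average_resolvent (R : realType) (N : nat) (S : 'M[R]_N)
    (w : 'I_N -> R[i]) (j : 'I_N) (l : R) :
  S^T = S -> (forall i, 0 < complex.Im (w i)) -> 0 < l ->
  (\int[lebesgue_measure]_t (cauchy_density l t *
     - complex.Im (\tr (resolvent S (fun i => if i == j then w i - t%:C%C else w i))))%:E =
   (- complex.Im (\tr (resolvent S
      (fun i => if i == j then w i + (0 +i* l)%C else w i))))%:E)%E.
Proof.
move=> Ssym w0 l0.
have [[u v] [[k0 k] [[p q] [/= v0 trE]]]] := resolvent_trace_shift j Ssym w0.
pose h t := - k + (p * v - q * (u - t)) / ((t - u) ^+ 2 + v ^+ 2).
have hE t : - complex.Im (\tr (resolvent S
    (fun i => if i == j then w i - t%:C%C else w i))) = h t.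
  rewrite trE//= /h oppr0 addr0; field.
  by rewrite gt_eqF ?sqr_add_sqr_gt0.
have h0 t : 0 <= h t.
  rewrite -hE oppr_ge0 Im_resolvent_trace_le0// => i.
  by case: ifP => // _; have := w0 i; case: (w i) => a b /=; rewrite subr0.
under eq_integral do rewrite hE.
rewrite cauchy_integral_pole//; congr EFin.
have -> : (fun i => if i == j then w i + (0 +i* l)%C else w i) =
    (fun i => if i == j then w i - (0 +i* - l)%C else w i).
  by apply/funext => i; case: ifP => // _; case: (w i) => a b /=; congr Complex; ring.
rewrite trE/= ?oppr_le0 ?ltW//; rewrite oppr0 addr0 opprK; field.
by rewrite gt_eqF// sqr_add_sqr_gt0 ?addr_gt0.
Qed.

(* The library equips [R] and [measurableTypeR R] with the same Borel sets but
   different displays; Lebesgue measure lives on the latter. *)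
Definition borel_rv (dT : measure_display) (T : measurableType dT)
    (R : realType) (P : probability T R) (X : {RV P >-> R}) :
  T -> measurableTypeR R := X.

Lemma measurable_borel_rv (dT : measure_display) (T : measurableType dT)
    (R : realType) (P : probability T R) (X : {RV P >-> R}) :
  measurable_fun setT (borel_rv X).
Proof. exact: (measurable_funPT X). Qed.

HB.instance Definition _ (dT : measure_display) (T : measurableType dT)
    (R : realType) (P : probability T R) (X : {RV P >-> R}) :=
  isMeasurableFun.Build _ _ _ _ (borel_rv X) (measurable_borel_rv X).

Definition borel_law (dT : measure_display) (T : measurableType dT)
    (R : realType) (P : probability T R) (X : {RV P >-> R}) :
  probability (measurableTypeR R) R := distribution P (borel_rv X).

(** * Laws with a density, and independence *)

(** The density is known through its integrals over Borel sets. These determine it almost everywhere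
    as the Radon-Nikodym derivative of the law, for which the change of variables holds. *)
Lemma integral_has_density (dT : measure_display) (T : measurableType dT)
    (R : realType) (P : probability T R) (X : {RV P >-> R}) (f : R -> R)
    (h : measurableTypeR R -> \bar R) :
  (forall x, 0 <= f x) -> measurable_fun (setT : set (measurableTypeR R)) f ->
  has_density X f -> (forall x, (0 <= h x)%E) -> measurable_fun setT h ->
  (\int[borel_law X]_x h x = \int[lebesgue_measure]_x (h x * (f x)%:E))%E.
Proof.
move=> f0 mf dX h0 mh.
pose nu : {finite_measure set (measurableTypeR R) -> \bar R} := borel_law X.
pose mu : {sigma_finite_measure set (measurableTypeR R) -> \bar R} := lebesgue_measure.
have nuE A : measurable A -> nu A = (\int[mu]_(x in A) (f x)%:E)%E.
  by move=> mA; rewrite -dX.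
have numu : nu `<< mu.
  apply/null_content_dominatesP => A mA A0; rewrite nuE//.
  by apply: null_set_integral => //; exact/measurable_EFinP/measurable_funTS.
rewrite -(Radon_Nikodym_SigmaFinite.change_of_variables numu h0 measurableT mh).
apply: ae_eq_integral => //.
- apply: emeasurable_funM => //.
  exact: measurable_int (Radon_Nikodym_SigmaFinite.f_integrable numu).
- by apply: emeasurable_funM => //; exact/measurable_EFinP.
- apply: ae_eqe_mul2l; apply: integral_ae_eq => //.
  + exact: Radon_Nikodym_SigmaFinite.f_integrable.
  + exact/measurable_EFinP.
  + move=> A _ mA; rewrite -Radon_Nikodym_SigmaFinite.f_integral//.
    by rewrite nuE.
Qed.

(** That [h] depends on [w] only through the events of [G] is expressed by the type of its first
    argument, the sample space with the smaller sigma-algebra. The identity into that space and [X]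
    have a product joint law, as rectangles already show, and Tonelli then integrates out [X] with
    [w] frozen. *)
Lemma independent_integral (dT : measure_display) (T : measurableType dT)
    (R : realType) (P : probability T R) (X : {RV P >-> R}) (f : R -> R)
    (G : set (set T)) (h : g_sigma_algebraType G * measurableTypeR R -> \bar R) :
  (forall U, G U -> measurable U) ->
  (forall U (B : set R), <<s G >> U -> measurable B ->
    P (U `&` X @^-1` B) = (P U * P (X @^-1` B))%E) ->
  (forall x, 0 <= f x) -> measurable_fun (setT : set (measurableTypeR R)) f ->
  has_density X f -> (forall z, (0 <= h z)%E) -> measurable_fun setT h ->
  (\int[P]_w h (w, X w) =
   \int[P]_w \int[lebesgue_measure]_t (h (w, t) * (f t)%:E))%E.
Proof.
move=> GT indep f0 mf dX h0 mh.
pose i : T -> g_sigma_algebraType G := id.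
have mi : measurable_fun setT i.
  move=> _ U sU; rewrite setTI preimage_id.
  apply: (smallest_sub _ _ sU) => //; exact: sigma_algebra_measurable.
pose j (w : T) : g_sigma_algebraType G * measurableTypeR R := (i w, borel_rv X w).
have mj : measurable_fun setT j.
  by apply/measurable_fun_pairP; split => //; exact: measurable_borel_rv.
pose ip : {mfun T >-> g_sigma_algebraType G} :=
  HB.pack i (isMeasurableFun.Build _ _ _ _ _ mi).
pose jp : {mfun T >-> (g_sigma_algebraType G * measurableTypeR R)%type} :=
  HB.pack j (isMeasurableFun.Build _ _ _ _ _ mj).
pose m1 : probability _ R := distribution P ip.
transitivity (\int[distribution P jp]_z h z)%E.
  by rewrite ge0_integral_distribution.
have mE A : measurable A -> distribution P jp A = (m1 \x borel_law X)%E A.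
  have rect (U : set (g_sigma_algebraType G)) (B : set (measurableTypeR R)) :
      measurable U -> measurable B ->
      distribution P jp (U `*` B) = (m1 U * borel_law X B)%E.
    exact: indep.
  by move=> mA; rewrite (product_measure_unique rect).
rewrite (eq_measure_integral (m1 \x borel_law X)%E); last by move=> A mA _; exact: mE.
rewrite fubini_tonelli1//.
rewrite ge0_integral_distribution//; last 2 first.
- exact: measurable_fun_fubini_tonelli_F.
- by move=> w; apply: integral_ge0 => t _; exact: h0.
apply: eq_integral => w _; rewrite /= /fubini_F.
rewrite (integral_has_density f0 mf dX)//.
exact: (measurableT_comp mh (measurable_pair1 _)).
Qed.

(** Generates the sigma-algebra of [a] together with the [d k] for [k] in [J]. Events of [a]
    intersected with boxes are stable under intersection, and on them the two independence
    hypotheses apply directly. *)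
Definition joint_pi_system (dT : measure_display) (T : measurableType dT)
    (R : realType) (P : probability T R) (I : Type) (K : finType)
    (a : I -> {RV P >-> R}) (d : K -> {RV P >-> R}) (J : {set K}) : set (set T) :=
  [set U | exists V (B : K -> set R), [/\ sigma_rv a V,
     forall k, measurable (B k) & U = V `&` \bigcap_(k in [set` J]) (d k @^-1` B k)]].

Lemma sigma_rv_measurable (dT : measure_display) (T : measurableType dT)
    (R : realType) (P : probability T R) (I : Type) (a : I -> {RV P >-> R}) V :
  sigma_rv a V -> measurable V.
Proof.
move=> aV; apply: (smallest_sub _ _ aV); first exact: sigma_algebra_measurable.
by move=> _ [i [B [mB ->]]]; exact: measurable_funPTI.
Qed.

Lemma sigma_rv_bigcap (dT : measure_display) (T : measurableType dT)
    (R : realType) (P : probability T R) (K : finType) (d : K -> {RV P >-> R})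
    (J : {set K}) (B : K -> set R) : (forall k, measurable (B k)) ->
  sigma_rv d (\bigcap_(k in [set` J]) (d k @^-1` B k)).
Proof.
move=> mB.
pose G := [set C | exists i (B : set R), measurable B /\ C = d i @^-1` B].
apply: (@fin_bigcap_measurable _ (g_sigma_algebraType G)) => // k _.
by apply: sub_sigma_algebra; exists k, (B k).
Qed.

Lemma joint_pi_system_measurable (dT : measure_display) (T : measurableType dT)
    (R : realType) (P : probability T R) (I : Type) (K : finType)
    (a : I -> {RV P >-> R}) (d : K -> {RV P >-> R}) (J : {set K}) U :
  joint_pi_system a d J U -> measurable U.
Proof.
move=> [V [B [aV mB ->]]]; apply: measurableI; first exact: sigma_rv_measurable aV.
exact: sigma_rv_measurable (sigma_rv_bigcap (d := d) J mB).
Qed.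

(** As functions of [U], both sides are finite measures; they agree on a generating pi-system, hence
    on the sigma-algebra. *)
Lemma joint_pi_system_indep (dT : measure_display) (T : measurableType dT)
    (R : realType) (P : probability T R) (I : Type) (K : finType)
    (a : I -> {RV P >-> R}) (d : K -> {RV P >-> R}) (J : {set K}) (j : K) :
  mutually_independent d -> independent_families a d -> j \notin J ->
  forall U (B : set R), <<s joint_pi_system a d J >> U -> measurable B ->
    P (U `&` d j @^-1` B) = (P U * P (d j @^-1` B))%E.
Proof.
move=> di adi jJ U B GU mB.
have mdB : measurable (d j @^-1` B) by exact: measurable_funPTI.
pose m1 : {measure set T -> \bar R} := mrestr P mdB.
have p0 : 0 <= fine (P (d j @^-1` B)) by exact: fine_ge0.
pose m2 : {measure set T -> \bar R} := mscale (NngNum p0) P.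
have m2E A : m2 A = (P A * P (d j @^-1` B))%E.
  rewrite /m2/= /mscale/= muleC fineK// fin_num_measure//.
rewrite -m2E -[LHS]/(m1 U).
have cap k (A : K -> set R) : (\bigcap_(k in [set` k |: J]) (d k @^-1` A k)) =
    d k @^-1` A k `&` \bigcap_(k in [set` J]) (d k @^-1` A k).
  rewrite -(bigcap_setU1 (fun k => d k @^-1` A k)); congr (bigcap _ _).
  apply/seteqP; split=> x /=; rewrite finset.in_setU1.
    by move=> /predU1P[->|xJ]; [left|right].
  by move=> [->|xJ]; rewrite ?eqxx ?xJ ?orbT.
apply: (g_sigma_algebra_measure_unique (joint_pi_system a d J) _ (fun _ => setT)) GU.
- by move=> A; exact: joint_pi_system_measurable.
- move=> _; exists setT, (fun=> setT); split=> //.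
    exact: (@measurableT _ (g_sigma_algebraType _)).
  by rewrite setTI; apply/esym/bigcapT => // k _; rewrite preimage_setT.
- by rewrite bigcup_const.
- move=> _ _ [V [A [aV mA ->]]] [V' [A' [aV' mA' ->]]].
  exists (V `&` V'), (fun k => A k `&` A' k); split.
  + exact: (@measurableI _ (g_sigma_algebraType _)).
  + by move=> k; exact: measurableI.
  + by rewrite setIACA -bigcapI.
- move=> _ [V [A [aV mA ->]]]; rewrite m2E /m1/= /mrestr/=.
  (* [B] becomes the [j]-th side of the box. As [j] is outside [J], the box over [J] is unchanged,
     and a single family of sides serves for [J] and for [J] with [j] added. *)
  pose A' k := if k == j then B else A k.
  have mA' k : measurable (A' k) by rewrite /A'; case: ifP.
  have -> : \bigcap_(k in [set` J]) (d k @^-1` A k) =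
      \bigcap_(k in [set` J]) (d k @^-1` A' k).
    apply: eq_bigcapr => k /= kJ; rewrite /A'; case: eqP => // kj.
    by rewrite -kj kJ in jJ.
  have eA' : d j @^-1` B = d j @^-1` A' j by rewrite /A' eqxx.
  rewrite -setIA [X in V `&` X]setIC eA' -cap.
  rewrite !adi//; try exact: sigma_rv_bigcap.
  rewrite !di// big_setU1//= -muleA; congr (_ * _)%E.
  by rewrite muleC.
- by move=> _; rewrite -ge0_fin_numE//; exact: fin_num_measure.
Qed.

(** * Measurability of the resolvent trace *)

Definition measurableC_fun (dT : measure_display) (T : measurableType dT)
    (R : realType) (f : T -> R[i]) : Prop :=
  measurable_fun setT (fun x => complex.Re (f x)) /\
  measurable_fun setT (fun x => complex.Im (f x)).

Lemma measurableC_real (dT : measure_display) (T : measurableType dT)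
    (R : realType) (f : T -> R) :
  measurable_fun setT f -> measurableC_fun (fun x => (f x)%:C%C).
Proof. by move=> mf; split. Qed.

Lemma measurableC_cst (dT : measure_display) (T : measurableType dT)
    (R : realType) (c : R[i]) : measurableC_fun (fun _ : T => c).
Proof. by split; exact: measurable_cst. Qed.

Lemma measurableC_add (dT : measure_display) (T : measurableType dT)
    (R : realType) (f g : T -> R[i]) :
  measurableC_fun f -> measurableC_fun g -> measurableC_fun (fun x => f x + g x).
Proof.
move=> [f1 f2] [g1 g2]; split.
  rewrite (_ : (fun x => _) = (fun x => complex.Re (f x)) \+ (fun x => complex.Re (g x))).
    exact: measurable_funD.
  by apply/funext => x /=; case: (f x); case: (g x).
rewrite (_ : (fun x => _) = (fun x => complex.Im (f x)) \+ (fun x => complex.Im (g x))).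
  exact: measurable_funD.
by apply/funext => x /=; case: (f x); case: (g x).
Qed.

Lemma measurableC_mul (dT : measure_display) (T : measurableType dT)
    (R : realType) (f g : T -> R[i]) :
  measurableC_fun f -> measurableC_fun g -> measurableC_fun (fun x => f x * g x).
Proof.
move=> [f1 f2] [g1 g2]; split.
  rewrite (_ : (fun x => _) = ((fun x => complex.Re (f x)) \* (fun x => complex.Re (g x))) \-
                        ((fun x => complex.Im (f x)) \* (fun x => complex.Im (g x)))).
    by apply: measurable_funB; exact: measurable_funM.
  by apply/funext => x /=; case: (f x); case: (g x).
rewrite (_ : (fun x => _) = ((fun x => complex.Re (f x)) \* (fun x => complex.Im (g x))) \+
                      ((fun x => complex.Im (f x)) \* (fun x => complex.Re (g x)))).
  by apply: measurable_funD; exact: measurable_funM.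
by apply/funext => x /=; case: (f x); case: (g x).
Qed.

Lemma measurableC_inv (dT : measure_display) (T : measurableType dT)
    (R : realType) (f : T -> R[i]) :
  measurableC_fun f -> measurableC_fun (fun x => (f x)^-1).
Proof.
move=> [f1 f2].
pose n x := (complex.Re (f x) ^+ 2 + complex.Im (f x) ^+ 2) `^ (-1).
have nE x : n x = (complex.Re (f x) ^+ 2 + complex.Im (f x) ^+ 2)^-1.
  by rewrite /n powR_inv1// addr_ge0 ?sqr_ge0.
have mn : measurable_fun setT n.
  apply: (measurableT_comp (@measurable_powR R (-1))).
  by apply: measurable_funD; exact: measurable_funX.
split.
  rewrite (_ : (fun x => _) = (fun x => complex.Re (f x)) \* n); first exact: measurable_funM.
  by apply/funext => x /=; rewrite nE; case: (f x).
rewrite (_ : (fun x => _) = -%R \o ((fun x => complex.Im (f x)) \* n)).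
  by apply: measurableT_comp => //; exact: measurable_funM.
by apply/funext => x /=; rewrite nE; case: (f x).
Qed.

Lemma measurableC_sum (dT : measure_display) (T : measurableType dT)
    (R : realType) (I : Type) (r : seq I) (f : I -> T -> R[i]) :
  (forall i, measurableC_fun (f i)) -> measurableC_fun (fun x => \sum_(i <- r) f i x).
Proof.
move=> mf; elim: r => [|i r IH].
  by under eq_fun do rewrite big_nil; exact: measurableC_cst.
by under eq_fun do rewrite big_cons; exact: measurableC_add.
Qed.

Lemma measurableC_prod (dT : measure_display) (T : measurableType dT)
    (R : realType) (I : Type) (r : seq I) (f : I -> T -> R[i]) :
  (forall i, measurableC_fun (f i)) -> measurableC_fun (fun x => \prod_(i <- r) f i x).
Proof.
move=> mf; elim: r => [|i r IH].
  by under eq_fun do rewrite big_nil; exact: measurableC_cst.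
by under eq_fun do rewrite big_cons; exact: measurableC_mul.
Qed.

Lemma measurableC_det (dT : measure_display) (T : measurableType dT)
    (R : realType) (n : nat) (M : T -> 'M[R[i]]_n) :
  (forall i j, measurableC_fun (fun x => M x i j)) ->
  measurableC_fun (fun x => \det (M x)).
Proof.
move=> mM; apply: measurableC_sum => s; apply: measurableC_mul.
  exact: measurableC_cst.
exact: measurableC_prod.
Qed.

Lemma measurableC_resolvent_trace (dT : measure_display) (T : measurableType dT)
    (R : realType) (n : nat) (S : T -> 'M[R]_n) (w : T -> 'I_n -> R[i]) :
  (forall x, (S x)^T = S x) -> (forall x i, 0 < complex.Im (w x i)) ->
  (forall i j, measurable_fun setT (fun x => S x i j)) ->
  (forall i, measurableC_fun (fun x => w x i)) ->
  measurableC_fun (fun x => \tr (resolvent (S x) (w x))).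
Proof.
move=> Ssym w0 mS mw.
have mp i j : measurableC_fun (fun x => pencil (S x) (w x) i j).
  under eq_fun do rewrite !mxE; apply: measurableC_add; last first.
    have -> : (fun x => - (S x i j)%:C%C) = (fun x => (- S x i j)%:C%C).
      by apply/funext => x; rewrite rmorphN.
    by apply: measurableC_real; exact: measurableT_comp.
  by case: (i == j) => /=; [exact: mw|exact: (measurableC_cst _ 0)].
apply: measurableC_sum => i.
(* Cramer's rule: a diagonal entry is a cofactor over the determinant. The pencil is invertible at
   every sample point, so [invmx] is the true inverse throughout. *)
have -> : (fun x => resolvent (S x) (w x) i i) =
    (fun x => (\det (pencil (S x) (w x)))^-1 *
      ((-1) ^+ (i + i) * \det (row' i (col' i (pencil (S x) (w x)))))).
  by apply/funext => x; rewrite /resolvent /invmx pencil_unit// !mxE.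
apply: measurableC_mul; first by apply: measurableC_inv; exact: measurableC_det.
apply: measurableC_mul; first exact: measurableC_cst.
by apply: measurableC_det => k l; under eq_fun do rewrite [row' _ _ _ _]mxE mxE; exact: mp.
Qed.

(** * Replacing the Cauchy entries one at a time *)

Lemma measurable_joint_fst (dT : measure_display) (T : measurableType dT)
    (R : realType) (P : probability T R) (I : Type) (K : finType)
    (a : I -> {RV P >-> R}) (d : K -> {RV P >-> R}) (J : {set K}) i :
  measurable_fun setT (a i : g_sigma_algebraType (joint_pi_system a d J) -> R).
Proof.
move=> _ B mB; rewrite setTI; apply: sub_sigma_algebra.
exists (a i @^-1` B), (fun=> setT); split=> //.
  by apply: sub_sigma_algebra; exists i, B.
by rewrite bigcapT ?setIT// => k _; rewrite preimage_setT.
Qed.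

Lemma measurable_joint_snd (dT : measure_display) (T : measurableType dT)
    (R : realType) (P : probability T R) (I : Type) (K : finType)
    (a : I -> {RV P >-> R}) (d : K -> {RV P >-> R}) (J : {set K}) k :
  k \in J ->
  measurable_fun setT (d k : g_sigma_algebraType (joint_pi_system a d J) -> R).
Proof.
move=> kJ _ B mB; rewrite setTI; apply: sub_sigma_algebra.
exists setT, (fun l => if l == k then B else setT); split=> //.
- exact: (@measurableT _ (g_sigma_algebraType _)).
- by move=> l; case: ifP.
rewrite setTI; apply/seteqP; split=> [w Bw l _ /=|w]; first by case: eqP => // ->.
by move=> /(_ k kJ)/=; rewrite eqxx.
Qed.

Lemma continuous_measurable_borel (R : realType) (f : R -> R) :
  continuous f -> measurable_fun (setT : set (measurableTypeR R)) f.
Proof. by move=> cf; exact: continuous_measurable_fun cf. Qed.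

(* Interpolates between the diagonal [z - d] of the resolvent of [A + D] ([m = 0])
   and the constant diagonal [z + i l] ([m = N]). *)
Definition hybrid (R : realType) (T : Type) (N : nat) (d : 'I_N -> T -> R)
    (l : R) (z : R[i]) (m : nat) (w : T) (i : 'I_N) : R[i] :=
  if (i < m)%N then z + (0 +i* l)%C else z - (d i w)%:C%C.

(** At stage [j] the entries before [j] are already constant, so apart from [d j] only [A] and the
    later [d k] remain random. They are independent of [d j] jointly, can be frozen, and the average
    over [d j] alone moves the [j]-th entry from [z - d j] to [z + il]. *)
Lemma expect_resolvent_step (R : realType) (dT : measure_display)
    (T : measurableType dT) (P : probability T R) (N : nat)
    (a : 'I_N -> 'I_N -> {RV P >-> R}) (d : 'I_N -> {RV P >-> R})
    (l : R) (A : T -> 'M[R]_N) (z : R[i]) (j : 'I_N) :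
  (forall w, A w = \matrix_(i, j) a i j w) -> (forall w, (A w)^T = A w) ->
  0 < l -> 0 < complex.Im z ->
  (forall i, has_density (d i) (cauchy_density l)) -> mutually_independent d ->
  independent_families (fun ij : 'I_N * 'I_N => a ij.1 ij.2) d ->
  (\int[P]_w (- complex.Im (\tr (resolvent (A w) (hybrid d l z j w))))%:E =
   \int[P]_w (- complex.Im (\tr (resolvent (A w) (hybrid d l z j.+1 w))))%:E)%E.
Proof.
move=> hA Asym l0 z0 dX di adi.
pose J := [set k : 'I_N | (j < k)%N]%SET.
pose av := fun ij : 'I_N * 'I_N => a ij.1 ij.2.
pose G := joint_pi_system av d J.
(* The [j]-th entry of [base] is the bare [z], common to both stages: subtracting [t] gives the
   integrand, adding [il] its average. *)
pose base (w : T) (i : 'I_N) := if (i < j)%N then z + (0 +i* l)%C else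
                if i == j then z else z - (d i w)%:C%C.
have base0 w i : 0 < complex.Im (base w i).
  rewrite /base; case: ifP => _; [|case: ifP => _ //];
    by case: (z) z0 => b c /=; rewrite ?subr0 ?oppr0 ?addr0// => c0; rewrite addr_gt0.
pose v (p : g_sigma_algebraType G * measurableTypeR R) (i : 'I_N) :=
  if i == j then base p.1 i - (p.2)%:C%C else base p.1 i.
have v0 p i : 0 < complex.Im (v p i).
  rewrite /v; case: ifP => // _; have := base0 p.1 i.
  by case: (base p.1 i) => b c /=; rewrite subr0.
pose h (p : g_sigma_algebraType G * measurableTypeR R) : \bar R :=
  (- complex.Im (\tr (resolvent (A p.1) (v p))))%:E.
have h0 p : (0 <= h p)%E.
  by rewrite lee_fin oppr_ge0 Im_resolvent_trace_le0.
have mfst (f : g_sigma_algebraType G -> R) : measurable_fun setT f ->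
    measurable_fun setT (fun p : g_sigma_algebraType G * measurableTypeR R => f p.1).
  by move=> mf; exact: (measurableT_comp mf measurable_fst).
have mh : measurable_fun setT h.
  apply/measurable_EFinP; apply: measurableT_comp => //.
  suff [] : measurableC_fun (fun p : g_sigma_algebraType G * measurableTypeR R =>
    \tr (resolvent (A p.1) (v p))) by [].
  apply: measurableC_resolvent_trace => //.
    move=> i k; under eq_fun do rewrite hA mxE.
    exact: (mfst _ (measurable_joint_fst (a := av) (d := d) (J := J) (i, k))).
  have mNr (f : g_sigma_algebraType G * measurableTypeR R -> R) :
      measurable_fun setT f -> measurableC_fun (fun p => - (f p)%:C%C).
    move=> mf; have -> : (fun p => - (f p)%:C%C) = (fun p => (- f p)%:C%C).
      by apply/funext => p; rewrite rmorphN.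
    by apply: measurableC_real; exact: measurableT_comp.
  move=> i; rewrite /v /base; have [->|ij] := eqVneq i j.
    rewrite ltnn; apply: measurableC_add; first exact: measurableC_cst.
    by apply: mNr; exact: measurable_snd.
  case: ltnP => ji; first exact: measurableC_cst.
  apply: measurableC_add; first exact: measurableC_cst.
  apply: mNr; apply: (mfst _ (measurable_joint_snd (a := av) (d := d) _)).
  by rewrite inE ltn_neqAle eq_sym ij.
have indep (U : set T) (B : set R) : <<s G >> U -> measurable B ->
    P (U `&` d j @^-1` B) = (P U * P (d j @^-1` B))%E.
  by apply: joint_pi_system_indep => //; rewrite inE ltnn.
have hybE w : (- complex.Im (\tr (resolvent (A w) (hybrid d l z j w))))%:E = h (w, d j w).
  rewrite /h /=; congr (- complex.Im (\tr (resolvent _ _)))%:E; apply/funext => i.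
  rewrite /v /base /hybrid /=; have [->|_] := eqVneq i j; first by rewrite ltnn.
  by [].
under eq_integral do rewrite hybE.
have GT U : G U -> measurable U by exact: joint_pi_system_measurable.
have g0 t : 0 <= cauchy_density l t by exact: cauchy_density_ge0.
have mg := continuous_measurable_borel (continuous_cauchy_density l0).
rewrite (independent_integral GT indep g0 mg (dX j) h0 mh).
apply: eq_integral => w _.
rewrite (_ : hybrid d l z j.+1 w =
    fun i => if i == j then base w i + (0 +i* l)%C else base w i); last first.
  apply/funext => i; rewrite /hybrid /base ltnS.
  have [->|ij] := eqVneq i j; first by rewrite leqnn ltnn.
  by rewrite leq_eqVlt (negbTE (ij : val i != val j)).
rewrite -(cauchy_average_resolvent j (Asym w) (base0 w) l0).
by apply: eq_integral => t _; rewrite /h /= -EFinM mulrC.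
Qed.

Lemma expect_poisson_trace (R : realType) (dT : measure_display)
    (T : measurableType dT) (P : probability T R) (N : nat)
    (a : 'I_N -> 'I_N -> {RV P >-> R}) (d : 'I_N -> {RV P >-> R})
    (l : R) (A : T -> 'M[R]_N) (x y : R) :
  (forall w, A w = \matrix_(i, j) a i j w) -> (forall w, (A w)^T = A w) ->
  0 < l -> 0 < y ->
  (forall i, has_density (d i) (cauchy_density l)) -> mutually_independent d ->
  independent_families (fun ij : 'I_N * 'I_N => a ij.1 ij.2) d ->
  (\int[P]_w (poisson_trace (A w + diag_mx (\row_i d i w)) x y)%:E =
   \int[P]_w (poisson_trace (A w) x (y + l))%:E)%E.
Proof.
move=> hA Asym l0 y0 dX di adi; pose z := (x +i* y)%C.
have steps m : (m <= N)%N ->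
    (\int[P]_w (- complex.Im (\tr (resolvent (A w) (hybrid d l z 0 w))))%:E =
     \int[P]_w (- complex.Im (\tr (resolvent (A w) (hybrid d l z m w))))%:E)%E.
  elim: m => [//|m IH] mN; apply: (etrans (IH (ltnW mN))).
  exact: (expect_resolvent_step (z := z) (Ordinal mN) hA Asym l0 y0 dX di adi).
transitivity (\int[P]_w (- complex.Im (\tr (resolvent (A w) (hybrid d l z 0 w))))%:E)%E.
  apply: eq_integral => w _; rewrite /poisson_trace /resolvent.
  congr (- complex.Im (\tr (invmx _)))%:E; apply/matrixP => i k; rewrite !mxE /hybrid /=.
  have [->|ik] := eqVneq i k; last by rewrite !mulr0n addr0.
  by rewrite !mulr1n rmorphD/= opprD [X in _ + X]addrC addrA.
apply: (etrans (steps N (leqnn N))); apply: eq_integral => w _.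
rewrite /poisson_trace; congr (- complex.Im (\tr (resolvent _ _)))%:E.
by apply/funext => i; rewrite /hybrid ltn_ord /z /=; congr Complex; rewrite addr0.
Qed.

(** * Recovering the eigenvalue count from the Poisson trace *)

Lemma cvg_sumr (R : realType) (T : Type) (F : set_system T) (FF : Filter F)
    (I : Type) (r : seq I) (f : I -> T -> R) (c : I -> R) :
  (forall i, f i x @[x --> F] --> c i) ->
  \sum_(i <- r) f i x @[x --> F] --> \sum_(i <- r) c i.
Proof. by move=> fc; apply: cvg_big => //; exact: add_continuous. Qed.

(** The integral of the Poisson trace up to [x], translated so that the domain is fixed: [x] may
    then depend on the sample point while measurability still follows from Tonelli on a product. *)
Definition smoothed_count (R : realType) (N : nat) (S : 'M[R]_N) (x y : R) : \bar R :=
  (\int[lebesgue_measure]_(s in `]-oo, 0%R]) (poisson_trace S (s + x) y)%:E)%E.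

Lemma poisson_trace_ge0 (R : realType) (N : nat) (S : 'M[R]_N) (x y : R) :
  S^T = S -> 0 < y -> 0 <= poisson_trace S x y.
Proof. by move=> Ssym y0; rewrite oppr_ge0 Im_resolvent_trace_le0. Qed.

Lemma smoothed_countE (R : realType) (N : nat) (S : 'M[R]_N) (x y : R) :
  smoothed_count S x y =
  (\int[lebesgue_measure]_s (poisson_trace S (s + x) y * \1_(`]-oo, 0%R]) s)%:E)%E.
Proof.
rewrite /smoothed_count integral_mkcond; apply: eq_integral => s _.
by rewrite epatch_indic/= EFinM.
Qed.

Lemma smoothed_count_spectrum (R : realType) (N : nat) (S : 'M[R]_N) : S^T = S ->
  exists e : 'I_N -> R,
    (forall x, esd S x = N%:R^-1 * \sum_j ((e j <= x)%R)%:R) /\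
    forall x y, 0 < y ->
      smoothed_count S x y = (\sum_j (atan ((x - e j) / y) + pi / 2))%:E.
Proof.
move=> Ssym; have [e [cE pE]] := poisson_trace_spectrum Ssym.
exists e; split=> [x|x y y0]; first exact: esd_spectrum.
pose f s := \sum_j y / ((s - (e j - x)) ^+ 2 + y ^+ 2).
pose F := \sum_j (fun s => atan ((s - (e j - x)) / y)).
have FE s : F s = \sum_j atan ((s - (e j - x)) / y) by rewrite /F fct_sumE.
have fE s : poisson_trace S (s + x) y = f s.
  by rewrite pE//; apply: eq_bigr => j _; congr (_ / (_ ^+ 2 + _)); ring.
have f0 s : 0 <= f s.
  apply: sumr_ge0 => j _; rewrite divr_ge0 ?ltW//; exact: sqr_add_sqr_gt0.
have cf : continuous f.
  move=> s; apply: (cvg_sumr _ (f := fun j s => y / ((s - (e j - x)) ^+ 2 + y ^+ 2))) => j.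
  apply: cvgM; first exact: cvg_cst.
  apply: cvgV; first by rewrite gt_eqF ?sqr_add_sqr_gt0.
  exact: continuous_sqr_add_sqr.
have dF (s : R) : is_derive s 1 F (f s).
  by apply: is_derive_sum => j; exact: is_derive_atan_affine.
have FNy : F s @[s --> -oo] --> \sum_(j < N) (- (pi / 2) : R).
  rewrite (_ : F = fun s => \sum_j atan ((s - (e j - x)) / y)); last exact/funext.
  apply: (cvg_sumr _ (f := fun j s => atan ((s - (e j - x)) / y))) => j.
  exact: cvgNy_atan_affine.
rewrite /smoothed_count; under eq_integral do rewrite fE.
rewrite (ge0_FTCNy 0 f0 cf dF FNy) FE -sumrB; congr EFin.
by apply: eq_bigr => j _; rewrite opprK sub0r opprB.
Qed.

Lemma measurable_poisson_trace (dT : measure_display) (T : measurableType dT)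
    (R : realType) (N : nat) (M : T -> 'M[R]_N) (x : T -> R) (y : R) :
  (forall w, (M w)^T = M w) -> (forall i j, measurable_fun setT (fun w => M w i j)) ->
  measurable_fun setT x -> 0 < y ->
  measurable_fun setT (fun w => poisson_trace (M w) (x w) y).
Proof.
move=> Msym mM mx y0.
rewrite (_ : (fun w => _) = -%R \o
    (fun w => complex.Im (\tr (resolvent (M w) (fun=> (x w +i* y)%C)))))//.
apply: measurableT_comp => //.
suff [] : measurableC_fun (fun w => \tr (resolvent (M w) (fun=> (x w +i* y)%C))) by [].
exact: measurableC_resolvent_trace.
Qed.

Lemma measurable_poisson_trace_pair (dT : measure_display) (T : measurableType dT)
    (R : realType) (N : nat) (M : T -> 'M[R]_N) (x : T -> R) (y : R) :
  (forall w, (M w)^T = M w) -> (forall i j, measurable_fun setT (fun w => M w i j)) ->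
  measurable_fun setT x -> 0 < y ->
  measurable_fun setT (fun p : T * measurableTypeR R =>
    (poisson_trace (M p.1) (p.2 + x p.1) y * \1_(`]-oo, 0%R]) p.2)%:E).
Proof.
move=> Msym mM mx y0; apply/measurable_EFinP; apply: measurable_funM; last first.
  by apply: (measurableT_comp _ measurable_snd); exact: measurable_indic.
apply: (measurable_poisson_trace (M := fun p : T * measurableTypeR R => M p.1)) => //.
  by move=> i j; exact: (measurableT_comp (mM i j) measurable_fst).
apply: measurable_funD; first exact: measurable_snd.
exact: (measurableT_comp mx measurable_fst).
Qed.

Lemma measurable_smoothed_count (dT : measure_display) (T : measurableType dT)
    (R : realType) (N : nat) (M : T -> 'M[R]_N) (x : T -> R) (y : R) :
  (forall w, (M w)^T = M w) -> (forall i j, measurable_fun setT (fun w => M w i j)) ->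
  measurable_fun setT x -> 0 < y ->
  measurable_fun setT (fun w => smoothed_count (M w) (x w) y).
Proof.
move=> Msym mM mx y0.
under eq_fun do rewrite smoothed_countE.
have mh := measurable_poisson_trace_pair Msym mM mx y0.
apply: (measurable_fun_fubini_tonelli_F _ mh _ (m2 := lebesgue_measure)) => p.
by rewrite lee_fin mulr_ge0 ?poisson_trace_ge0.
Qed.

Lemma expect_smoothed_count (dT : measure_display) (T : measurableType dT)
    (R : realType) (P : probability T R) (N : nat) (M : T -> 'M[R]_N) (x y : R) :
  (forall w, (M w)^T = M w) -> (forall i j, measurable_fun setT (fun w => M w i j)) ->
  0 < y ->
  (\int[P]_w smoothed_count (M w) x y =
   \int[lebesgue_measure]_s ((\1_(`]-oo, 0%R]) s)%:E *
     \int[P]_w (poisson_trace (M w) (s + x) y)%:E))%E.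
Proof.
move=> Msym mM y0.
have mh := measurable_poisson_trace_pair Msym mM (measurable_cst x) y0.
under eq_integral do rewrite smoothed_countE.
rewrite (fubini_tonelli _ mh (m1 := P) (m2 := lebesgue_measure)) => [|p]; last first.
  by rewrite lee_fin mulr_ge0 ?poisson_trace_ge0.
apply: eq_integral => s _ /=; under eq_integral do rewrite mulrC EFinM.
rewrite ge0_integralZl//.
  by apply/measurable_EFinP; exact: measurable_poisson_trace.
by move=> w _; rewrite lee_fin poisson_trace_ge0.
Qed.

(* The shift [1/n] dominates the width [1/n^2], so that the limit is the closed
   indicator, with value [1] (and not [1/2]) at [u = 0]. *)
Lemma cvg_atan_step (R : realType) (u : R) :
  atan ((u + n.+1%:R^-1) / (n.+1%:R^-1 ^+ 2)) + pi / 2 @[n --> \oo] -->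
  pi * (0 <= u)%R%:R.
Proof.
have arg n : (u + n.+1%:R^-1) / (n.+1%:R^-1 ^+ 2) = n.+1%:R * (n.+1%:R * u + 1) :> R.
  have : n.+1%:R != 0 :> R by rewrite pnatr_eq0.
  by move: n.+1%:R => m m0; field.
under eq_fun do rewrite arg.
have Sy : (n.+1%:R : R) @[n --> \oo] --> +oo.
  by apply/cvgryPge => M; near=> n; rewrite (le_trans _ (_ : n%:R <= _)) ?ler_nat//;
    near: n; exact: nbhs_infty_ger.
have [u0|u0] := leP 0 u.
  have -> : pi * true%:R = pi / 2 + pi / 2 :> R by rewrite mulr1 -splitr.
  apply: cvgD; last exact: cvg_cst.
  apply: (cvg_comp _ _ _ (@cvgy_atan R)).
  apply: (ger_cvgy _ Sy); near=> n.
  by rewrite ler_peMr// lerDr mulr_ge0.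
have -> : pi * false%:R = - (pi / 2) + pi / 2 :> R by rewrite mulr0 addNr.
apply: cvgD; last exact: cvg_cst.
have -> : (fun n : nat => atan (n.+1%:R * (n.+1%:R * u + 1))) =
    (fun n : nat => - atan (n.+1%:R * (n.+1%:R * - u - 1))).
  by apply/funext => n; rewrite -atanN -mulrN opprB mulrN opprK addrC.
apply: cvgN; apply: (cvg_comp _ _ _ (@cvgy_atan R)).
apply: (ger_cvgy _ Sy); near=> n.
rewrite ler_peMr// lerBrDr -ler_pdivrMr ?oppr_gt0//.
by rewrite (le_trans _ (_ : n%:R <= _)) ?ler_nat//; near: n; exact: nbhs_infty_ger.
Unshelve. all: by end_near. Qed.

Lemma cvg_smoothed_count (R : realType) (N : nat) (S : 'M[R]_N) (x : R) :
  (0 < N)%N -> S^T = S ->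
  smoothed_count S (x + n.+1%:R^-1) (n.+1%:R^-1 ^+ 2) @[n --> \oo] -->
  (N%:R * pi * esd S x)%:E.
Proof.
move=> N0 Ssym; have [e [eE sE]] := smoothed_count_spectrum Ssym.
under eq_fun do rewrite sE ?exprn_gt0 ?invr_gt0//.
apply: cvg_EFin; first exact: nearW.
have -> : N%:R * pi * esd S x = \sum_j (pi * (0 <= x - e j)%R%:R).
  rewrite eE mulrAC mulrA mulfV ?pnatr_eq0 -?lt0n// mul1r mulrC mulr_sumr.
  by apply: eq_bigr => j _; rewrite subr_ge0.
apply: (cvg_sumr _ (f := fun j n =>
  atan ((x + n.+1%:R^-1 - e j) / n.+1%:R^-1 ^+ 2) + pi / 2)) => j.
under eq_fun do rewrite addrAC.
exact: cvg_atan_step.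
Qed.

Lemma smoothed_count_ge0 (R : realType) (N : nat) (S : 'M[R]_N) (x y : R) :
  S^T = S -> 0 < y -> (0 <= smoothed_count S x y)%E.
Proof.
by move=> Ssym y0; apply: integral_ge0 => s _; rewrite lee_fin poisson_trace_ge0.
Qed.

Lemma smoothed_count_le (R : realType) (N : nat) (S : 'M[R]_N) (x y : R) :
  S^T = S -> 0 < y -> (smoothed_count S x y <= (N%:R * pi)%:E)%E.
Proof.
move=> Ssym y0; have [e [_ ->//]] := smoothed_count_spectrum Ssym.
rewrite lee_fin; apply: (@le_trans _ _ (\sum_(j < N) (pi : R))).
  by apply: ler_sum => j _; rewrite {2}(splitr pi) lerD2r ltW// atan_ltpi2.
by rewrite sumr_const card_ord mulr_natl.
Qed.

Lemma esd_ge0 (R : realType) (N : nat) (S : 'M[R]_N) (x : R) :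
  S^T = S -> 0 <= esd S x.
Proof.
move=> Ssym; have [e [-> _]] := smoothed_count_spectrum Ssym.
by rewrite mulr_ge0 ?invr_ge0//; apply: sumr_ge0.
Qed.

Lemma esd_le1 (R : realType) (N : nat) (S : 'M[R]_N) (x : R) :
  (0 < N)%N -> S^T = S -> esd S x <= 1.
Proof.
move=> N0 Ssym; have [e [-> _]] := smoothed_count_spectrum Ssym.
rewrite mulrC ler_pdivrMr ?ltr0n// mul1r.
apply: (@le_trans _ _ (\sum_(j < N) (1 : R))).
  by apply: ler_sum => j _; case: (e j <= x).
by rewrite sumr_const card_ord.
Qed.

(** Up to the factor [N%:R * pi], a pointwise limit of smoothed counts, which are measurable through
    the resolvent. The point [x] may vary with [w], so that the lemma gives joint measurability when
    [x] is a projection of a product space. *)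
Lemma measurable_esd (dT : measure_display) (T : measurableType dT)
    (R : realType) (N : nat) (M : T -> 'M[R]_N) (x : T -> R) :
  (0 < N)%N -> (forall w, (M w)^T = M w) ->
  (forall i j, measurable_fun setT (fun w => M w i j)) ->
  measurable_fun setT x -> measurable_fun setT (fun w => esd (M w) (x w)).
Proof.
move=> N0 Msym mM mx.
have c0 : N%:R * pi != 0 :> R by rewrite mulf_neq0 ?gt_eqF ?ltr0n ?pi_gt0.
have -> : (fun w => esd (M w) (x w)) =
    (fun w => (N%:R * pi)^-1 * fine (N%:R * pi * esd (M w) (x w))%:E).
  by apply/funext => w; rewrite /= mulKf.
apply: measurable_funM => //; apply: measurableT_comp => //.
apply: (emeasurable_fun_cvg
  (fun n w => smoothed_count (M w) (x w + n.+1%:R^-1) (n.+1%:R^-1 ^+ 2))).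
  move=> n; apply: measurable_smoothed_count => //.
  exact: measurable_funD.
by move=> w _; exact: cvg_smoothed_count.
Qed.

Lemma expect_bounded_cvg (dT : measure_display) (T : measurableType dT)
    (R : realType) (P : probability T R) (f : nat -> T -> \bar R) (g : T -> \bar R)
    (C : R) :
  (forall n, measurable_fun setT (f n)) -> (forall n w, (0 <= f n w <= C%:E)%E) ->
  (forall w, f n w @[n --> \oo] --> g w) ->
  (\int[P]_w f n w @[n --> \oo] --> \int[P]_w g w)%E.
Proof.
move=> mf fC fg; apply: (@dominated_cvg _ _ _ P _ measurableT f g (cst C%:E)) => //.
- exact: finite_measure_integrable_cst.
- by move=> n w _; have /andP[f0 fl] := fC n w; rewrite gee0_abs.
Qed.

(** Here the width stays above [l > 0], so the limit is mere continuity of the arctangent, without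
    the jump of the vanishing-width case. *)
Lemma cvg_smoothed_count_shift (R : realType) (N : nat) (S : 'M[R]_N) (x l : R) :
  S^T = S -> 0 < l ->
  smoothed_count S (x + n.+1%:R^-1) (n.+1%:R^-1 ^+ 2 + l) @[n --> \oo] -->
  smoothed_count S x l.
Proof.
move=> Ssym l0; have [e [_ sE]] := smoothed_count_spectrum Ssym.
under eq_fun do rewrite sE ?ltr_wpDl//.
rewrite sE//; apply: cvg_EFin; first exact: nearW.
apply: (cvg_sumr _ (f := fun j n =>
  atan ((x + n.+1%:R^-1 - e j) / (n.+1%:R^-1 ^+ 2 + l)) + pi / 2)) => j.
apply: cvgD; last exact: cvg_cst.
have h0 : n.+1%:R^-1 @[n --> \oo] --> (0 : R) by exact: cvg_harmonic.
have arg : (x + n.+1%:R^-1 - e j) / (n.+1%:R^-1 ^+ 2 + l) @[n --> \oo] -->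
    (x + 0 - e j) / (0 * 0 + l).
  apply: cvgM.
    by apply: cvgB; [apply: cvgD => //; exact: cvg_cst|exact: cvg_cst].
  apply: cvgV; first by rewrite mul0r add0r gt_eqF.
  by apply: cvgD; [under eq_fun do rewrite expr2; exact: cvgM|exact: cvg_cst].
rewrite addr0 mul0r add0r in arg.
exact: (cvg_comp _ _ arg (@continuous_atan R _)).
Qed.

(** The expected smoothed counts of [A + D] at width [y_ n] and of [A] at width [y_ n + l] agree for
    every [n]. Both are dominated by [N%:R * pi], so the limit passes under the expectation: the
    first width shrinks to 0, the second to [l]. *)
Lemma expect_esd_add_cauchy (R : realType) (dT : measure_display)
    (T : measurableType dT) (P : probability T R) (N : nat)
    (a : 'I_N -> 'I_N -> {RV P >-> R}) (d : 'I_N -> {RV P >-> R})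
    (l : R) (A : T -> 'M[R]_N) (x : R) : (0 < N)%N ->
  (forall w, A w = \matrix_(i, j) a i j w) -> (forall w, (A w)^T = A w) -> 0 < l ->
  (forall i, has_density (d i) (cauchy_density l)) -> mutually_independent d ->
  independent_families (fun ij : 'I_N * 'I_N => a ij.1 ij.2) d ->
  (\int[P]_w (N%:R * pi * esd (A w + diag_mx (\row_i d i w)) x)%:E =
   \int[P]_w smoothed_count (A w) x l)%E.
Proof.
move=> N0 hA Asym l0 dX di adi.
pose M w := A w + diag_mx (\row_i d i w).
have Msym w : (M w)^T = M w by rewrite /M linearD/= Asym tr_diag_mx.
have mA i j : measurable_fun setT (fun w => A w i j).
  by under eq_fun do rewrite hA mxE; exact: (measurable_funPT (a i j)).
have mM i j : measurable_fun setT (fun w => M w i j).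
  under eq_fun do rewrite /M !mxE; apply: measurable_funD; first exact: mA.
  by case: (i == j); [exact: (measurable_funPT (d i))|
    exact: (@measurable_cst _ _ _ _ _ (0 : R))].
pose x_ n : R := x + n.+1%:R^-1; pose y_ n : R := n.+1%:R^-1 ^+ 2.
have y0 n : 0 < y_ n by rewrite exprn_gt0// invr_gt0.
have step n : (\int[P]_w smoothed_count (M w) (x_ n) (y_ n) =
               \int[P]_w smoothed_count (A w) (x_ n) (y_ n + l))%E.
  apply: (etrans (expect_smoothed_count P (x_ n) Msym mM (y0 n))).
  apply: (etrans _ (esym (expect_smoothed_count P (x_ n) Asym mA (addr_gt0 (y0 n) l0)))).
  apply: eq_integral => s _.
  apply: (f_equal (mule _)).
  exact (expect_poisson_trace (s + x_ n) hA Asym l0 (y0 n) dX di adi).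
have l1 : (\int[P]_w smoothed_count (M w) (x_ n) (y_ n) @[n --> \oo] -->
    \int[P]_w (N%:R * pi * esd (M w) x)%:E)%E.
  apply: (@expect_bounded_cvg _ _ _ _ _ _ (N%:R * pi)).
  - by move=> n; exact: measurable_smoothed_count.
  - by move=> n w; rewrite smoothed_count_ge0//= smoothed_count_le.
  - by move=> w; exact: cvg_smoothed_count.
have l2 : (\int[P]_w smoothed_count (A w) (x_ n) (y_ n + l) @[n --> \oo] -->
    \int[P]_w smoothed_count (A w) x l)%E.
  apply: (@expect_bounded_cvg _ _ _ _ _ _ (N%:R * pi)).
  - by move=> n; apply: measurable_smoothed_count => //; rewrite addr_gt0.
  - by move=> n w; rewrite smoothed_count_ge0 ?addr_gt0//= smoothed_count_le ?addr_gt0.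
  - by move=> w; exact: cvg_smoothed_count_shift.
rewrite (_ : (fun n => _) =
  (fun n => \int[P]_w smoothed_count (A w) (x_ n) (y_ n + l))%E) in l1; last exact/funext.
exact: cvg_unique l1 l2.
Qed.

(** * Convolution of the Cauchy density with distribution functions *)

Definition cauchy_cdf (R : realType) (l u : R) : R := atan (u / l) / pi + 2^-1.

Lemma cauchy_cdf_ge0 (R : realType) (l u : R) : 0 <= cauchy_cdf l u.
Proof.
rewrite /cauchy_cdf -lerBlDr sub0r ler_pdivlMr ?pi_gt0// mulNr [2^-1 * _]mulrC.
exact/ltW/atan_gtNpi2.
Qed.

Lemma cauchy_cdf_le1 (R : realType) (l u : R) : cauchy_cdf l u <= 1.
Proof.
rewrite /cauchy_cdf -lerBrDr {1}(splitr 1) mul1r addrK ler_pdivrMr ?pi_gt0// [2^-1 * _]mulrC.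
exact/ltW/atan_ltpi2.
Qed.

Lemma continuous_cauchy_density_sub (R : realType) (l x : R) : 0 < l ->
  continuous (fun t => cauchy_density l (x - t)).
Proof.
move=> l0 t; apply: (@continuous_comp _ _ _ (fun t => x - t) (cauchy_density l)).
  by apply: cvgB; [exact: cvg_cst|].
exact: (continuous_cauchy_density l0).
Qed.

Lemma integral_cauchy_tail (R : realType) (l x e : R) : 0 < l ->
  (\int[lebesgue_measure]_t (cauchy_density l (x - t) * ((e <= t)%R)%:R)%:E =
   (cauchy_cdf l (x - e))%:E)%E.
Proof.
move=> l0; pose f t := cauchy_density l (x - t).
pose F t := pi^-1 * atan ((t - x) / l).
have -> : (fun t => (cauchy_density l (x - t) * (e <= t)%R%:R)%:E) =
    (fun t => (f t)%:E) \_ `[e, +oo[.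
  apply/funext => t; rewrite /patch /f.
  have -> : (t \in `[e, +oo[%classic) = (e <= t) by rewrite mem_setE in_itv/= andbT.
  by case: (e <= t); rewrite ?mulr1 ?mulr0.
have f0 t : 0 <= f t by exact: cauchy_density_ge0.
have cf : continuous f.
  exact: continuous_cauchy_density_sub.
have dF (t : R) : is_derive t 1 F (f t).
  apply: (is_derive_eq (is_deriveZ pi^-1 (is_derive_atan_affine x t l0))).
  by rewrite /GRing.scale/= /f /cauchy_density -[x - t]opprB sqrrN.
have Fy : F t @[t --> +oo] --> pi^-1 * (pi / 2).
  by apply: cvgM; [exact: cvg_cst|exact: cvgy_atan_affine].
rewrite -integral_mkcond (ge0_FTCy e f0 cf dF Fy); congr EFin.
rewrite /F /cauchy_cdf -[x - e]opprB mulNr atanN mulrA mulVf ?gt_eqF ?pi_gt0//.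
by rewrite mul1r addrC mulNr [_ / pi]mulrC.
Qed.

(** Each summand [atan + pi / 2] is [pi] times [cauchy_cdf] at [x - e j], itself a tail integral of
    the density. Written against the values of [esd], not against point masses, the convolution can
    be averaged over the sample space by Tonelli. *)
Lemma smoothed_count_conv (R : realType) (N : nat) (S : 'M[R]_N) (x l : R) :
  (0 < N)%N -> S^T = S -> 0 < l ->
  (smoothed_count S x l = (N%:R * pi)%:E *
    \int[lebesgue_measure]_t (cauchy_density l (x - t) * esd S t)%:E)%E.
Proof.
move=> N0 Ssym l0; have [e [eE sE]] := smoothed_count_spectrum Ssym.
have mg : measurable_fun (setT : set (measurableTypeR R)) (fun t => cauchy_density l (x - t)).
  by apply: continuous_measurable_borel; exact: continuous_cauchy_density_sub.
pose f j t := N%:R^-1 * (cauchy_density l (x - t) * ((e j <= t)%R)%:R).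
have f0 j t : 0 <= f j t.
  by rewrite mulr_ge0 ?invr_ge0// mulr_ge0// cauchy_density_ge0.
have mi j : measurable_fun (setT : set (measurableTypeR R))
    (fun t => ((e j <= t)%R)%:R : R).
  have -> : (fun t => ((e j <= t)%R)%:R : R) = \1_(`[e j, +oo[).
    by apply/funext => t; rewrite indicE mem_setE in_itv/= andbT.
  exact: measurable_indic.
have mf j : measurable_fun (setT : set (measurableTypeR R)) (f j).
  by apply: measurable_funM => //; exact: measurable_funM.
under eq_integral => t _.
  rewrite (_ : cauchy_density l (x - t) * esd S t = \sum_j f j t); last first.
    by rewrite eE mulrCA !mulr_sumr.
  rewrite -sumEFin.
  over.
rewrite ge0_integral_sum//; last 2 first.
- by move=> j; exact/measurable_EFinP.
- by move=> j t _; rewrite lee_fin.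
rewrite sE// (eq_bigr (fun j => (N%:R^-1 * cauchy_cdf l (x - e j))%:E)) => [|j _].
  rewrite sumEFin -EFinM mulr_sumr; congr EFin; apply: eq_bigr => j _.
  rewrite mulrA [N%:R * pi / _]mulrAC mulfV ?pnatr_eq0 -?lt0n// mul1r.
  by rewrite /cauchy_cdf mulrDr mulrCA mulfV ?mulr1// gt_eqF ?pi_gt0.
under eq_integral do rewrite EFinM.
rewrite ge0_integralZl ?lee_fin ?invr_ge0//.
- by rewrite integral_cauchy_tail.
- by apply/measurable_EFinP; exact: measurable_funM.
- by move=> t _; rewrite lee_fin mulr_ge0 ?cauchy_density_ge0.
Qed.

Lemma fine_expectation (dT : measure_display) (T : measurableType dT)
    (R : realType) (P : probability T R) (N : nat) (M : T -> 'M[R]_N) (x : R) :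
  (0 < N)%N -> (forall w, (M w)^T = M w) ->
  (forall i j, measurable_fun setT (fun w => M w i j)) ->
  ((expected_esd P M x)%:E = \int[P]_w (esd (M w) x)%:E)%E.
Proof.
move=> N0 Msym mM; rewrite /expected_esd unlock fineK//.
have mesd : measurable_fun setT (fun w => (esd (M w) x)%:E).
  by apply/measurable_EFinP; exact: measurable_esd.
rewrite ge0_fin_numE; last by apply: integral_ge0 => w _; rewrite lee_fin esd_ge0.
apply: (@le_lt_trans _ _ (\int[P]_w (cst 1%E w))%E); last first.
  rewrite integral_cst// mul1e.
  by apply: (le_lt_trans (probability_le1 P measurableT)); exact: ltry.
apply: ge0_le_integral => //.
- by move=> w _; rewrite lee_fin esd_ge0.
- by move=> w _; rewrite lee_fin esd_le1.
Qed.

Lemma expected_esd_conv (R : realType) (dT : measure_display)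
    (T : measurableType dT) (P : probability T R) (N : nat)
    (a : 'I_N -> 'I_N -> {RV P >-> R}) (d : 'I_N -> {RV P >-> R})
    (l : R) (A : T -> 'M[R]_N) (x : R) : (0 < N)%N ->
  (forall w, A w = \matrix_(i, j) a i j w) -> (forall w, (A w)^T = A w) -> 0 < l ->
  (forall i, has_density (d i) (cauchy_density l)) -> mutually_independent d ->
  independent_families (fun ij : 'I_N * 'I_N => a ij.1 ij.2) d ->
  ((expected_esd P (fun w => A w + diag_mx (\row_i d i w)%R) x)%:E =
   \int[lebesgue_measure]_t (cauchy_density l (x - t) * expected_esd P A t)%:E)%E.
Proof.
move=> N0 hA Asym l0 dX di adi.
pose M w := A w + diag_mx (\row_i d i w).
have Msym w : (M w)^T = M w by rewrite /M linearD/= Asym tr_diag_mx.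
have mA i j : measurable_fun setT (fun w => A w i j).
  by under eq_fun do rewrite hA mxE; exact: (measurable_funPT (a i j)).
have mM i j : measurable_fun setT (fun w => M w i j).
  under eq_fun do rewrite /M !mxE; apply: measurable_funD; first exact: mA.
  by case: (i == j); [exact: (measurable_funPT (d i))|
    exact: (@measurable_cst _ _ _ _ _ (0 : R))].
have c0 : 0 < N%:R * pi :> R by rewrite mulr_gt0 ?ltr0n ?pi_gt0.
have mesd : measurable_fun setT (fun p : T * measurableTypeR R =>
    (cauchy_density l (x - p.2) * esd (A p.1) p.2)%:E).
  apply/measurable_EFinP; apply: measurable_funM.
    apply: (measurableT_comp (f := fun t : measurableTypeR R => cauchy_density l (x - t))
      _ measurable_snd).
    by apply: continuous_measurable_borel; exact: continuous_cauchy_density_sub.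
  apply: (measurable_esd (M := fun p : T * measurableTypeR R => A p.1)) => //.
  by move=> i j; exact: (measurableT_comp (mA i j) measurable_fst).
have h0 (p : T * measurableTypeR R) :
    (0 <= (cauchy_density l (x - p.2) * esd (A p.1) p.2)%:E)%E.
  by rewrite lee_fin mulr_ge0 ?cauchy_density_ge0 ?esd_ge0.
have e1 := expect_esd_add_cauchy x N0 hA Asym l0 dX di adi.
(* The limit and convolution identities both carry the factor [N%:R * pi]; equality is proved with
   it and the factor, being nonzero, is cancelled at the end. *)
have e2 : ((N%:R * pi)%:E * \int[P]_w (esd (M w) x)%:E = (N%:R * pi)%:E *
    \int[lebesgue_measure]_t (cauchy_density l (x - t) * expected_esd P A t)%:E)%E.
  rewrite -ge0_integralZl ?lee_fin ?(ltW c0)//; last 2 first.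
  - by apply/measurable_EFinP; exact: measurable_esd.
  - by move=> w _; rewrite lee_fin esd_ge0.
  under eq_integral do rewrite -EFinM.
  apply: (etrans e1).
  under eq_integral do rewrite (smoothed_count_conv x N0 (Asym _) l0).
  rewrite ge0_integralZl ?lee_fin ?(ltW c0)//; last 2 first.
  - exact: (measurable_fun_fubini_tonelli_F _ mesd h0 (m2 := lebesgue_measure)).
  - by move=> w _; apply: integral_ge0 => t _; exact: (h0 (w, t)).
  apply: (f_equal (mule _)).
  rewrite (fubini_tonelli _ mesd h0 (m1 := P) (m2 := lebesgue_measure)).
  apply: eq_integral => t _ /=; under eq_integral do rewrite EFinM.
  rewrite ge0_integralZl ?lee_fin ?cauchy_density_ge0//.
  - by rewrite -fine_expectation// EFinM.
  - by apply/measurable_EFinP; exact: measurable_esd.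
  - by move=> w _; rewrite lee_fin esd_ge0.
rewrite (fine_expectation P x N0 Msym mM).
have := f_equal (mule (N%:R * pi)^-1%:E) e2.
by rewrite !muleA -EFinM mulVf ?(gt_eqF c0)// !mul1e.
Qed.

(** * Convolution against the measure, and its derivatives *)

(** Integration by parts in the form of Tonelli: [L] of the half line is the integral of the
    indicator of [y <= t], and exchanging the integrals leaves a tail of the density. All
    derivatives now fall on the smooth factor. *)
Lemma integral_cauchy_conv (R : realType) (l x : R)
    (L : probability (measurableTypeR R) R) : 0 < l ->
  (\int[lebesgue_measure]_t ((cauchy_density l (x - t))%:E * L `]-oo, t]%classic) =
   \int[L]_y (cauchy_cdf l (x - y))%:E)%E.
Proof.
move=> l0.
pose h (p : measurableTypeR R * measurableTypeR R) : \bar R :=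
  (cauchy_density l (x - p.2) * ((p.1 <= p.2)%R)%:R)%:E.
have mle : measurable_fun setT
    (fun p : measurableTypeR R * measurableTypeR R => ((p.1 <= p.2)%R)%:R : R).
  have -> : (fun p : measurableTypeR R * measurableTypeR R => ((p.1 <= p.2)%R)%:R : R) =
      (fun p => if (p.1 <= p.2)%R then 1 else 0).
    by apply/funext => p; case: (p.1 <= p.2)%R.
  apply: measurable_fun_ifT => //.
  exact: (measurable_fun_ler measurable_fst measurable_snd).
have mh : measurable_fun setT h.
  apply/measurable_EFinP; apply: measurable_funM => //.
  apply: (measurableT_comp (f := fun t : measurableTypeR R => cauchy_density l (x - t))
      _ measurable_snd).
  by apply: continuous_measurable_borel; exact: continuous_cauchy_density_sub.
have h0 p : (0 <= h p)%E by rewrite lee_fin mulr_ge0 ?cauchy_density_ge0.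
transitivity (\int[L]_y \int[lebesgue_measure]_t h (y, t))%E; last first.
  by apply: eq_integral => y _; exact: integral_cauchy_tail.
rewrite (fubini_tonelli _ mh h0 (m1 := L) (m2 := lebesgue_measure)).
apply: eq_integral => t _; rewrite /h /=; under eq_integral do rewrite EFinM.
have E : (fun y : measurableTypeR R => ((y <= t)%R%:R : R)%:E) =
    (fun y => (\1_(`]-oo, t]%classic) y)%:E).
  by apply/funext => y; rewrite indicE mem_setE in_itv.
rewrite ge0_integralZl ?lee_fin ?cauchy_density_ge0//.
- by rewrite E integral_indic// setIT.
- by rewrite E; apply/measurable_EFinP; exact: measurable_indic.
Qed.

(* With [r = 1/(x^2 + l^2)] and [s = x/(x^2 + l^2)] one has [r' = -2rs] and
   [s' = r - 2s^2], so this algebra of bounded functions is stable under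
   differentiation; it contains the Cauchy density. *)
Inductive lorentz_alg (R : realType) (l : R) : (R -> R) -> Prop :=
| lorentz_cst c : lorentz_alg l (fun=> c)
| lorentz_r : lorentz_alg l (fun x => (x ^+ 2 + l ^+ 2)^-1)
| lorentz_s : lorentz_alg l (fun x => x / (x ^+ 2 + l ^+ 2))
| lorentz_add f g : lorentz_alg l f -> lorentz_alg l g ->
    lorentz_alg l (fun x => f x + g x)
| lorentz_mul f g : lorentz_alg l f -> lorentz_alg l g ->
    lorentz_alg l (fun x => f x * g x).

Lemma lorentz_bounded (R : realType) (l : R) f : 0 < l -> lorentz_alg l f ->
  exists M, forall x, `|f x| <= M.
Proof.
move=> l0; have D0 x : 0 < x ^+ 2 + l ^+ 2 by exact: sqr_add_sqr_gt0.
elim=> [c|||{}f g _ [M fM] _ [M' gM]|{}f g _ [M fM] _ [M' gM]].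
- by exists `|c|.
- exists (l ^- 2) => x; rewrite ger0_norm ?invr_ge0 ?(ltW (D0 x))//.
  by rewrite lef_pV2 ?posrE ?exprn_gt0// lerDr sqr_ge0.
- exists l^-1 => x; rewrite normrM normfV [`|_ + _|]ger0_norm ?(ltW (D0 x))//.
  rewrite ler_pdivrMr// mulrC -ler_pdivrMr ?invr_gt0// invrK.
  rewrite -[x ^+ 2]real_normK ?num_real//.
  by have := sqr_ge0 (`|x| - l); have := sqr_ge0 (`|x|); have := sqr_ge0 l; nra.
- by exists (M + M') => x; rewrite (le_trans (ler_normD _ _))// lerD.
- by exists (M * M') => x; rewrite normrM ler_pM.
Qed.

Lemma lorentz_derive (R : realType) (l : R) f : 0 < l -> lorentz_alg l f ->
  exists2 g, lorentz_alg l g & forall x : R, is_derive x 1 f (g x).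
Proof.
move=> l0; have D0 x : x ^+ 2 + l ^+ 2 != 0 by rewrite gt_eqF ?sqr_add_sqr_gt0.
elim=> [c|||{}f g fL [f' f'L df] gL [g' g'L dg]|{}f g fL [f' f'L df] gL [g' g'L dg]].
- by exists (fun=> 0); [exact: lorentz_cst|move=> x; exact: is_derive_cst].
- exists (fun x => -2 * ((x ^+ 2 + l ^+ 2)^-1 * (x / (x ^+ 2 + l ^+ 2)))).
    apply: lorentz_mul; first exact: lorentz_cst.
    by apply: lorentz_mul; [exact: lorentz_r|exact: lorentz_s].
  move=> x; have H := is_derive_affine_div_sqr 0 1 x l0.
  rewrite (_ : (fun x => _) = (fun t => (0 * t + 1) / (t ^+ 2 + l ^+ 2))); last first.
    by apply/funext => t; rewrite mul0r add0r mul1r.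
  by apply: (is_derive_eq H); field.
- exists (fun x => (x ^+ 2 + l ^+ 2)^-1 +
      -2 * ((x / (x ^+ 2 + l ^+ 2)) * (x / (x ^+ 2 + l ^+ 2)))).
    apply: lorentz_add; first exact: lorentz_r.
    apply: lorentz_mul; first exact: lorentz_cst.
    by apply: lorentz_mul; exact: lorentz_s.
  move=> x; have H := is_derive_affine_div_sqr 1 0 x l0.
  rewrite (_ : (fun x => _) = (fun t => (1 * t + 0) / (t ^+ 2 + l ^+ 2))); last first.
    by apply/funext => t; rewrite mul1r addr0.
  by apply: (is_derive_eq H); field.
- exists (fun x => f' x + g' x); first exact: lorentz_add.
  by move=> x; exact: is_deriveD.
- exists (fun x => f x * g' x + g x * f' x).
    by apply: lorentz_add; exact: lorentz_mul.
  by move=> x; exact: is_deriveM.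
Qed.

Lemma lorentz_derive1n (R : realType) (l : R) f k : 0 < l -> lorentz_alg l f ->
  lorentz_alg l (f^`(k)%classic).
Proof.
move=> l0 fL; elim: k => [//|k IH]; rewrite derive1nS.
have [g gL dg] := lorentz_derive l0 IH.
rewrite (_ : (f^`(k)^`())%classic = g)//.
by apply/funext => x; rewrite derive1E derive_val.
Qed.

Lemma lorentz_derivable (R : realType) (l : R) f : 0 < l -> lorentz_alg l f ->
  forall x : R, is_derive x 1 f (f^`()%classic x).
Proof.
move=> l0 fL x; have [g gL dg] := lorentz_derive l0 fL.
by rewrite derive1E derive_val.
Qed.

Lemma lorentz_cauchy_density (R : realType) (l : R) : lorentz_alg l (cauchy_density l).
Proof.
apply: lorentz_mul; first exact: lorentz_cst.
by apply: lorentz_mul; [exact: lorentz_cst|exact: lorentz_r].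
Qed.

Lemma integrable_conv (R : realType) (L : probability (measurableTypeR R) R)
    (h : R -> R) (C x : R) :
  continuous h -> (forall t, `|h t| <= C) ->
  L.-integrable setT (EFin \o (fun y : measurableTypeR R => h (x - y))).
Proof.
move=> ch hC.
have cx : continuous (fun y => h (x - y)).
  move=> t; apply: (@continuous_comp _ _ _ (fun t => x - t) h); last exact: ch.
  by apply: cvgB; [exact: cvg_cst|].
apply: (@le_integrable _ _ _ _ _ measurableT _ (EFin \o cst C)).
- by apply/measurable_EFinP; exact: (continuous_measurable_borel cx).
- by move=> y _ /=; rewrite lee_fin (le_trans (hC _))// ler_norm.
- exact: finite_measure_integrable_cst.
Qed.

(** On a probability space constants are integrable: the bound on [h] makes the integrals finite,
    the bound on [h'] dominates the difference quotients. The interval around [x] of radius 1 is an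
    arbitrary choice, both bounds being global. *)
Lemma is_derive_conv (R : realType) (L : probability (measurableTypeR R) R)
    (h h' : R -> R) (C M : R) :
  (forall x : R, is_derive x 1 h (h' x)) ->
  (forall t, `|h t| <= C) -> (forall t, `|h' t| <= M) ->
  forall x : R, is_derive x 1 (fun x => \int[L]_y h (x - y)) (\int[L]_y h' (x - y)).
Proof.
move=> dh hC hM x.
have ch : continuous h.
  by move=> t; apply: differentiable_continuous; apply/derivable1_diffP; exact: ex_derive.
pose f x (y : measurableTypeR R) := h (x - y).
have df (s y : R) : is_derive s 1 (fun s => f s y) (h' (s - y)).
  have ds : is_derive s 1 (fun s : R => s - y) 1.
    have -> : (fun s : R => s - y) = (id - cst y) :> (R -> R) by [].
    by apply: is_derive_eq; rewrite subr0.
  have H := @is_derive1_comp _ h (fun s => s - y) s _ _ (dh (s - y)) ds.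
  by apply: (is_derive_eq H); rewrite mulr1.
have M0 : 0 <= M by rewrite (le_trans _ (hM 0)).
have Ix : `]x - 1, x + 1[%classic x by rewrite /= in_itv/= gtrBl ltrDl ltr01.
have intf s : `]x - 1, x + 1[%classic s -> L.-integrable setT (EFin \o f s).
  by move=> _; exact: integrable_conv ch hC.
have derf s y : `]x - 1, x + 1[%classic s -> setT y -> derivable (f ^~ y) s 1.
  by move=> _ _; have H := df s y; exact: ex_derive.
have d1E s y : partial1of2 f s y = h' (s - y).
  by rewrite partial1of2E; have H := df s y; exact: derive_val.
have Gub s y : `]x - 1, x + 1[%classic s -> setT y -> `|partial1of2 f s y| <= cst M y.
  by move=> _ _; rewrite d1E.
have intG : L.-integrable setT (EFin \o cst M).
  exact: finite_measure_integrable_cst.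
apply: DeriveDef.
  exact: (derivable_under_integral measurableT Ix intf derf (fun=> M0) intG Gub).
rewrite -derive1E.
rewrite (differentiation_under_integral measurableT Ix intf derf (fun=> M0) intG Gub).
by apply: eq_Rintegral => y _; exact: d1E.
Qed.

(** * The expected law as a Lebesgue-Stieltjes measure *)

(** [b c] is the eventual truth value of [c <= u n]. Taking [b] to be [c <= x], constantly true or
    constantly false yields right continuity and the limits at both infinities from one statement;
    it is asked for all [c] because the eigenvalues vary with the sample point. *)
Lemma esd_cvg (R : realType) (N : nat) (S : 'M[R]_N) : S^T = S ->
  exists e : 'I_N -> R, (forall x, esd S x = N%:R^-1 * \sum_j ((e j <= x)%R)%:R) /\
  forall (u : nat -> R) (b : R -> bool),
    (forall c, \forall n \near \oo, (c <= u n) = b c) ->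
    esd S (u n) @[n --> \oo] --> (N%:R^-1 * \sum_j (b (e j))%:R : R).
Proof.
move=> Ssym; have [e [eE _]] := smoothed_count_spectrum Ssym.
exists e; split=> // u b ub; under eq_fun do rewrite eE.
apply: cvgM; first exact: cvg_cst.
apply: (cvg_sumr _ (f := fun j n => ((e j <= u n)%R)%:R)) => j.
have eu : \forall n \near \oo, (b (e j))%:R = ((e j <= u n)%R)%:R :> R.
  by apply: filterS (ub (e j)) => n ->.
by apply: cvg_trans (near_eq_cvg eu) _; exact: cvg_cst.
Qed.

Lemma expected_esd_cvg (dT : measure_display) (T : measurableType dT)
    (R : realType) (P : probability T R) (N : nat) (M : T -> 'M[R]_N)
    (u : nat -> R) (c : T -> R) (r : R) :
  (0 < N)%N -> (forall w, (M w)^T = M w) ->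
  (forall i j, measurable_fun setT (fun w => M w i j)) ->
  (forall w, esd (M w) (u n) @[n --> \oo] --> c w) ->
  (\int[P]_w (c w)%:E = r%:E)%E ->
  expected_esd P M (u n) @[n --> \oo] --> r.
Proof.
move=> N0 Msym mM uc cr; apply: fine_cvg; rewrite -cr.
have eE n : ('E_P[fun w => esd (M w) (u n)] = \int[P]_w (esd (M w) (u n))%:E)%E.
  by rewrite unlock.
under eq_fun do rewrite eE.
apply: (@expect_bounded_cvg _ _ _ _ _ _ 1).
- by move=> n; apply/measurable_EFinP; exact: measurable_esd.
- by move=> n w; rewrite !lee_fin esd_ge0//= esd_le1.
- by move=> w; apply: cvg_EFin; [exact: nearW|exact: uc].
Qed.

Lemma exists_expected_law (dT : measure_display) (T : measurableType dT)
    (R : realType) (P : probability T R) (N : nat) (M : T -> 'M[R]_N) :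
  (0 < N)%N -> (forall w, (M w)^T = M w) ->
  (forall i j, measurable_fun setT (fun w => M w i j)) ->
  exists L : probability (measurableTypeR R) R,
    forall x : R, L `]-oo, x]%classic = (expected_esd P M x)%:E.
Proof.
move=> N0 Msym mM; pose F := expected_esd P M.
have FE x : ((F x)%:E = \int[P]_w (esd (M w) x)%:E)%E by exact: fine_expectation.
have Fnd : nondecreasing F.
  move=> x y xy; rewrite -lee_fin !FE; apply: ge0_le_integral => //.
  - by move=> w _; rewrite lee_fin esd_ge0.
  - by apply/measurable_EFinP; exact: measurable_esd.
  - by apply/measurable_EFinP; exact: measurable_esd.
  - move=> w _; rewrite lee_fin; have [e [eE _]] := esd_cvg (Msym w).
    rewrite !eE ler_wpM2l ?invr_ge0//; apply: ler_sum => j _.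
    by case: (leP (e j) x) => // ex; rewrite (le_trans ex xy).
have Frc : forall x, F y @[y --> x^'+] --> F x.
  move=> x; apply/cvg_at_rightP => u [ux u_x].
  apply: (expected_esd_cvg (c := fun w => esd (M w) x)) => // w.
  have [e [eE ecvg]] := esd_cvg (Msym w); rewrite eE.
  (* The sequence approaches [x] strictly from the right: a threshold [c <= x] is passed by every
     term, a threshold [c > x] by none from some rank on. *)
  apply: (ecvg u (fun c => c <= x)) => c; have [cx|cx] := leP c x; near=> n.
    by rewrite (le_trans cx)// ltW.
  by apply/negbTE; rewrite -ltNge; near: n; exact: cvgr_lt u_x _ cx.
have Fy : F x @[x --> +oo] --> (1 : R).
  apply/cvg_pinftyP => u uy.
  apply: (expected_esd_cvg (c := fun=> 1)) => // [w|]; last first.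
    by rewrite integral_cst// mul1e; exact: probability_setT.
  have [e [eE ecvg]] := esd_cvg (Msym w).
  have := ecvg u xpredT; rewrite sumr_const card_ord mulVf ?pnatr_eq0 -?lt0n//.
  by apply=> c; near=> n; near: n; move/cvgryPge : uy; exact.
have FNy : F x @[x --> -oo] --> (0 : R).
  apply/cvg_ninftyP => u uy.
  apply: (expected_esd_cvg (c := fun=> 0)) => // [w|]; last by rewrite integral0.
  have [e [eE ecvg]] := esd_cvg (Msym w).
  have := ecvg u xpred0; rewrite big1// mulr0; apply=> c; near=> n.
  by apply/negbTE; rewrite -ltNge; near: n; move/cvgrNyPlt : uy; exact.
pose Fc : cumulativeBounded (0 : R) (1 : R) := HB.pack F
  (isCumulative.Build R _ R F Fnd Frc) (isCumulativeBounded.Build R 0 1 F FNy Fy).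
exists (lebesgue_stieltjes_measure Fc) => x.
rewrite -[RHS](cdf_lebesgue_stieltjes_id Fc x).
by [].
Unshelve. all: by end_near. Qed.

(** * Smoothness and the derivative formula *)

Lemma is_derive_cauchy_cdf (R : realType) (l t : R) : 0 < l ->
  is_derive t 1 (cauchy_cdf l) (cauchy_density l t).
Proof.
move=> l0.
have H := is_deriveD (is_deriveZ pi^-1 (is_derive_atan_affine 0 t l0))
  (is_derive_cst (2^-1 : R) t 1).
rewrite (_ : cauchy_cdf l = (pi^-1 \*: (fun t => atan ((t - 0) / l))) + cst 2^-1).
  apply: (is_derive_eq H).
  by rewrite /GRing.scale/= addr0 subr0.
apply/funext => s; rewrite -[RHS]/(pi^-1 * atan ((s - 0) / l) + 2^-1).
by rewrite subr0 mulrC.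
Qed.

Theorem corollary1p4 (R : realType) (dT : measure_display)
    (T : measurableType dT) (P : probability T R) (N : nat) (hN : (1 <= N)%N)
    (a : 'I_N -> 'I_N -> {RV P >-> R}) (d : 'I_N -> {RV P >-> R})
    (lambda : R) (A D : T -> 'M[R]_N)
    (hA : forall w, A w = \matrix_(i, j) a i j w)
    (hD : forall w, D w = diag_mx (\row_i d i w))
    (a_sym : forall w, (A w)^T = A w)
    (lambda_gt0 : 0 < lambda)
    (d_cauchy : forall i, has_density (d i) (cauchy_density lambda))
    (d_indep : mutually_independent d)
    (ad_indep : independent_families (fun ij : 'I_N * 'I_N => a ij.1 ij.2) d) :
  let F := expected_esd P A in
  let Ftilde := expected_esd P (fun w => A w + D w) in
  let rho : R -> R := Ftilde^`()%classic in
  let is_L (L : probability (measurableTypeR R) R) :=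
    forall x : R, L `]-oo, x]%classic = (F x)%:E in
  [/\ exists L, is_L L,
      forall (n : nat) (x : R), derivable (Ftilde^`(n)%classic) x 1
    & forall L, is_L L -> forall (k : nat) (x : R),
        (rho^`(k)%classic x)%:E =
        (\int[L]_y ((cauchy_density lambda)^`(k)%classic (x - y))%:E)%E].
Proof.
move=> F Ftilde rho is_L; pose g := cauchy_density lambda.
have mA i j : measurable_fun setT (fun w => A w i j).
  by under eq_fun do rewrite hA mxE; exact: (measurable_funPT (a i j)).
have exL : exists L, is_L L by exact: exists_expected_law.
have gk k : lorentz_alg lambda (g^`(k)%classic).
  exact: (lorentz_derive1n k lambda_gt0 (lorentz_cauchy_density lambda)).
have gB k := lorentz_bounded lambda_gt0 (gk k).
have dg k (x : R) : is_derive x 1 (g^`(k)%classic) (g^`(k.+1)%classic x).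
  by rewrite derive1nS; exact: (lorentz_derivable lambda_gt0 (gk k)).
have FtE L : is_L L -> Ftilde = fun x => \int[L]_y cauchy_cdf lambda (x - y).
  move=> LF; apply/funext => x; rewrite /Rintegral -integral_cauchy_conv//.
  have -> : Ftilde = expected_esd P (fun w => A w + diag_mx (\row_i d i w)).
    by rewrite /Ftilde; congr (expected_esd P _); apply/funext => w; rewrite hD.
  apply: (etrans (f_equal fine
    (expected_esd_conv x hN hA a_sym lambda_gt0 d_cauchy d_indep ad_indep))).
  apply: (f_equal fine); apply: eq_integral => t _.
  by rewrite LF EFinM.
(* The first differentiation stands apart: [cauchy_cdf] involves an arctangent, so its bound is the
   1 of a distribution function and not one from [lorentz_bounded]. From its derivative [g] onwards
   everything stays in the algebra. *)
have dF L : is_L L -> forall x : R,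
    is_derive x 1 Ftilde (\int[L]_y g (x - y)).
  move=> LF x; rewrite (FtE L LF); have [M gM] := gB 0%N.
  apply: (is_derive_conv (C := 1) _ _ _ gM) => [t|t].
    exact: is_derive_cauchy_cdf.
  by rewrite ger0_norm ?cauchy_cdf_ge0// cauchy_cdf_le1.
have dFk L : is_L L -> forall k (x : R),
    is_derive x 1 (fun x => \int[L]_y g^`(k)%classic (x - y))
      (\int[L]_y g^`(k.+1)%classic (x - y)).
  move=> LF k x; have [C gC] := gB k; have [M gM] := gB k.+1.
  exact: (is_derive_conv L (dg k) gC gM x).
have rhoE L : is_L L -> forall k, rho^`(k)%classic =
    fun x => \int[L]_y g^`(k)%classic (x - y).
  move=> LF; elim=> [|k IH].
    by apply/funext => x; rewrite /rho /= derive1E; have H := dF L LF x; exact: derive_val.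
  rewrite derive1nS IH; apply/funext => x; rewrite derive1E.
  by have H := dFk L LF k x; exact: derive_val.
split=> //.
(* Smoothness does not mention [L], yet its proof runs through the convolution, so some [L] must
   exist first. Order 0 is [dF]; from order 1 on the derivatives of [Ftilde] are those of [rho]. *)
- have [L LF] := exL; case=> [|n] x; first by have H := dF L LF x; exact: ex_derive.
  have -> : Ftilde^`(n.+1)%classic = rho^`(n)%classic by rewrite /rho /derive1n -iterSr.
  by rewrite (rhoE L LF); have H := dFk L LF n x; exact: ex_derive.
(* [rhoE] holds for the real-valued integral; boundedness of the [k]-th derivative makes the
   extended one finite, so the two agree. *)
- move=> L LF k x; rewrite (rhoE L LF) /Rintegral fineK//.
  have [M gM] := gB k.
  apply: integrable_fin_num => //; apply: (@integrable_conv _ L _ M x _ gM) => t.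
  by have H := dg k t; apply: differentiable_continuous;
    apply/derivable1_diffP; exact: ex_derive.
Qed.
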